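(* Let $\Bbbk$ be any field, let $x=(x_1,\dots,x_n)$, and let $M=\Bbbk[[x]]^s/N$ for some integer $s$ and some $\Bbbk[[x]]$-submodule $N$ of $\Bbbk[[x]]^s$. Assume that $N$ is generated (as a $\Bbbk[[x]]$-module) by a $\Bbbk\langle x\rangle$-submodule of $\Bbbk\langle x\rangle^s$. Then there exists a constant $C'>0$ such that $$\operatorname{ord}_{M}(p)\leq C'\cdot\deg(p)\qquad\text{for all } p\in \Bbbk[x]^s\setminus N.$$
   Context: $\Bbbk\langle x\rangle$ denotes the ring of algebraic power series: those $f\in\Bbbk[[x]]$ with $P(x,f(x))=0$ for some non-zero $P(x,T)\in\Bbbk[x,T]$. For $p\in\Bbbk[x]^s$, $\deg(p)$ is the maximum of the total degrees of its components. For $m\in M\setminus\{0\}$, $\operatorname{ord}_M(m)=\sup\{c\in\mathbb{N} : m\in (x)^cM\}$ with $(x)=(x_1,\dots,x_n)$; for $p\in\Bbbk[x]^s$, $\operatorname{ord}_M(p)$ means the order of the image of $p$ in $M$.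
   Formalization: The bound proved is ord_M(p) ≤ C'·max(1, deg(p)) instead of C'·deg(p); as stated the claim fails for constant vectors: with n=1, s=2, N=k[[x]]·(1,x), p=(1,0) has degree 0 but order 1 in M. *)

(* Defs.v *)
From HB Require Import structures.
From mathcomp Require Import all_boot all_order all_algebra.
From mathcomp Require Import boolp.
From mathcomp Require Export mpoly.

Set Implicit Arguments.
Unset Strict Implicit.
Unset Printing Implicit Defensive.

Import GRing.Theory.

Local Open Scope ring_scope.

(* Formal power series in n variables, as families of coefficients indexed by
   monomials.  The product is the Cauchy product, written as in [mcoeffM]. *)
Record mfps (n : nat) (R : Type) := MFPS { mfcoef : 'X_{1..n} -> R }.

Notation "{ 'mfps' R [ n ] }" := (mfps n R)
  (at level 0, R at level 2, n at level 2, format "{ 'mfps'  R [ n ] }")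
  : type_scope.

HB.instance Definition _ (n : nat) (R : Type) := gen_eqMixin {mfps R[n]}.
HB.instance Definition _ (n : nat) (R : Type) := gen_choiceMixin {mfps R[n]}.

Lemma mfpsP (n : nat) (R : Type) (f g : {mfps R[n]}) :
  (forall m, mfcoef f m = mfcoef g m) -> f = g.
Proof. by case: f g => f [g] /= /funext ->. Qed.

Section PowerSeriesRing.

Context (n : nat) (R : comNzRingType).

Implicit Types f g h : {mfps R[n]}.

Definition mfps_zero : {mfps R[n]} := MFPS (fun=> 0).
Definition mfps_opp f : {mfps R[n]} := MFPS (fun m => - mfcoef f m).
Definition mfps_add f g : {mfps R[n]} :=
  MFPS (fun m => mfcoef f m + mfcoef g m).
Definition mfps_one : {mfps R[n]} := MFPS (fun m => (m == 0%MM)%:R).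
Definition mfps_mul f g : {mfps R[n]} :=
  MFPS (fun m =>
    \sum_(k : 'X_{1..n < (mdeg m).+1, (mdeg m).+1} | m == (k.1 + k.2)%MM)
      (mfcoef f k.1 * mfcoef g k.2)).

Let addA : associative mfps_add.
Proof. by move=> f g h; apply: mfpsP => m /=; rewrite addrA. Qed.
Let addC : commutative mfps_add.
Proof. by move=> f g; apply: mfpsP => m /=; rewrite addrC. Qed.
Let add0 : left_id mfps_zero mfps_add.
Proof. by move=> f; apply: mfpsP => m /=; rewrite add0r. Qed.
Let addN : left_inverse mfps_zero mfps_opp mfps_add.
Proof. by move=> f; apply: mfpsP => m /=; rewrite addNr. Qed.

HB.instance Definition _ :=
  GRing.isZmodule.Build {mfps R[n]} addA addC add0 addN.

Definition mfps_trunc (b : nat) f : {mpoly R[n]} :=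
  \sum_(m : 'X_{1..n < b}) (mfcoef f m *: 'X_[m]).

Lemma mcoeff_trunc b f m :
  (mdeg m < b)%N -> (mfps_trunc b f)@_m = mfcoef f m.
Proof. exact: mcoeff_mpoly. Qed.

Lemma mcoeffM_low (b : nat) (p q p' q' : {mpoly R[n]}) :
  (forall m, (mdeg m < b)%N -> p@_m = p'@_m) ->
  (forall m, (mdeg m < b)%N -> q@_m = q'@_m) ->
  forall m, (mdeg m < b)%N -> (p * q)@_m = (p' * q')@_m.
Proof.
move=> pp qq m mb; rewrite !mcoeffM; apply: eq_bigr => k _.
by rewrite pp ?qq // (leq_trans (bmdeg _)).
Qed.

Lemma mfcoefM_trunc (b : nat) f g m : (mdeg m < b)%N ->
  mfcoef (mfps_mul f g) m = (mfps_trunc b f * mfps_trunc b g)@_m.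
Proof.
move=> mb; rewrite mcoeffM; apply: eq_bigr => k _.
by rewrite !mcoeff_trunc // (leq_trans (bmdeg _)).
Qed.

Let mulA : associative mfps_mul.
Proof.
move=> f g h; apply: mfpsP => m; set b := (mdeg m).+1.
rewrite !(@mfcoefM_trunc b) //.
transitivity (mfps_trunc b f * (mfps_trunc b g * mfps_trunc b h))@_m.
  apply: (@mcoeffM_low b) => // u ub.
  by rewrite mcoeff_trunc // (@mfcoefM_trunc b).
rewrite mulrA; apply: (@mcoeffM_low b) => // u ub.
by rewrite mcoeff_trunc // (@mfcoefM_trunc b).
Qed.

Let mulC : commutative mfps_mul.
Proof.
move=> f g; apply: mfpsP => m.
by rewrite !(@mfcoefM_trunc (mdeg m).+1) // mulrC.
Qed.

Let mul1 : left_id mfps_one mfps_mul.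
Proof.
move=> f; apply: mfpsP => m; set b := (mdeg m).+1.
rewrite (@mfcoefM_trunc b) // -(@mcoeff_trunc b f) //.
rewrite -[in RHS](mul1r (mfps_trunc b f)); apply: (@mcoeffM_low b) => // u ub.
by rewrite mcoeff_trunc // mcoeff1.
Qed.

Let mulDl : left_distributive mfps_mul +%R.
Proof.
move=> f g h; apply: mfpsP => m /=; rewrite -big_split; apply: eq_bigr => k _.
by rewrite /= mulrDl.
Qed.

Let one_neq0 : mfps_one != 0.
Proof.
apply/eqP => /(congr1 (fun f : {mfps R[n]} => mfcoef f 0%MM)) /= /eqP.
by rewrite eqxx oner_eq0.
Qed.

HB.instance Definition _ :=
  GRing.Zmodule_isComNzRing.Build {mfps R[n]} mulA mulC mul1 mulDl one_neq0.

Definition mfps_of_mpoly (p : {mpoly R[n]}) : {mfps R[n]} :=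
  MFPS (fun m => p@_m).

Let of_mpolyB : zmod_morphism mfps_of_mpoly.
Proof. by move=> p q; apply: mfpsP => m; rewrite /= mcoeffB. Qed.

HB.instance Definition _ :=
  GRing.isZmodMorphism.Build {mpoly R[n]} {mfps R[n]} mfps_of_mpoly of_mpolyB.

Let of_mpolyM : monoid_morphism mfps_of_mpoly.
Proof.
split=> [|p q]; apply: mfpsP => m; first by rewrite /= mcoeff1.
by rewrite /= mcoeffM.
Qed.

HB.instance Definition _ :=
  GRing.isMonoidMorphism.Build {mpoly R[n]} {mfps R[n]} mfps_of_mpoly of_mpolyM.

End PowerSeriesRing.

(* [algebraicOver] requires both rings to be fields; k[x, T] is read as
   k[x][T]. *)
Definition algebraic_series (k : fieldType) (n : nat) (f : {mfps k[n]}) : Prop :=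
  exists2 P : {poly {mpoly k[n]}},
    P != 0 & root (map_poly (@mfps_of_mpoly n k) P) f.

Definition lin_span (R : nzRingType) (V : lmodType R) (S : V -> Prop) (v : V) :
    Prop :=
  exists (r : nat) (a : 'I_r -> R) (w : 'I_r -> V),
    (forall i, S (w i)) /\ v = \sum_(i < r) a i *: w i.

Definition algebraic_submodule (k : fieldType) (n s : nat)
    (L : {pred 'rV[{mfps k[n]}]_s}) : Prop :=
  [/\ forall u, u \in L -> forall j, algebraic_series (u 0 j),
      0 \in L &
      forall a u v, algebraic_series a -> u \in L -> v \in L ->
        a *: u + v \in L].

(* The ideal (x)^c, generated by the products of c variables, that is, by the
   monomials of degree c. *)
Definition xideal_exp (k : fieldType) (n c : nat) : {mfps k[n]} -> Prop :=
  lin_span (V := {mfps k[n]}^o)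
    (fun g => exists2 m : 'X_{1..n}, mdeg m = c & g = mfps_of_mpoly 'X_[m]).

Section Order.

Context (k : fieldType) (n s : nat) (N : {pred 'rV[{mfps k[n]}]_s}).

(* The class of v in M = k[[x]]^s / N lies in (x)^c M: it is a finite sum of
   products of an element of (x)^c and the class of some w in k[[x]]^s. *)
Definition class_in_xexp (c : nat) (v : 'rV[{mfps k[n]}]_s) : Prop :=
  exists2 u, lin_span
      (fun w => exists (f : {mfps k[n]}) (w' : 'rV[{mfps k[n]}]_s),
          xideal_exp c f /\ w = f *: w') u
    & v - u \in N.

(* ord_M of the class of v is the natural number o; a v for which no such o
   exists has infinite order. *)
Definition has_ord (v : 'rV[{mfps k[n]}]_s) (o : nat) : Prop :=
  (forall c, class_in_xexp c v -> (c <= o)%N) /\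
  (forall b, (forall c, class_in_xexp c v -> (c <= b)%N) -> (o <= b)%N).

End Order.

Definition pvec_series (k : fieldType) (n s : nat) (p : 'rV[{mpoly k[n]}]_s) :
    'rV[{mfps k[n]}]_s :=
  map_mx (@mfps_of_mpoly n k) p.

(* [msize] is one more than the total degree; the zero component counts as
   degree 0.  A bound linear in the degree has to be taken with maxn 1 (deg p):
   modulo k[[x]](1, x) the constant vector (1, 0) has degree 0 but order 1. *)
Definition pvec_deg (k : fieldType) (n s : nat) (p : 'rV[{mpoly k[n]}]_s) : nat :=
  \max_(j < s) (msize (p 0%R j)).-1.

(* Main.v *)
(* Write x = (x', X).  Let g be a nonzero maximal minor of a matrix of algebraic
   elements of N.  Cramer's rule gives linear forms w with algebraic coefficients
   that vanish on N and are such that w(v) = 0 implies g v in N.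

   If w(v) <> 0, then ord v <= ord w(v).  The entries of w(v) are polynomials, of
   degree linear in deg v, in finitely many fixed algebraic series; such a series
   f is a root of a polynomial over k[x] whose coefficients have degree O(deg v)
   (Cayley-Hamilton), so that f divides one of these coefficients and
   ord f = O(deg v).

   If w(v) = 0 and v is not in N, take a polynomial multiple h <> 0 of g.  Then
   v is not in N + h k[[x]]^s either: w(v + h q) = 0 implies w(q) = 0, hence h q is
   in N.  After a change of coordinates, h is regular in X, and Weierstrass
   division turns k[[x]]^s / (N + h) into a quotient of k[[x']]^(s a), to which the
   induction on the number of variables applies.

   This requires the remainder of an algebraic series f modulo h to have algebraic
   coefficients.  The roots of h in X may be multiple or inseparable, so divide by
   h + t in k[[x', t, X]] instead, with t a new variable.  A root al of h + t is
   not algebraic over k(x'), since otherwise t = - h(al) would be.  Hence the roots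
   are simple (provided dh/dX <> 0) and a nonzero polynomial over k[x] does not
   vanish at al, so that the equation of f shows that the remainder takes algebraic
   values at the roots.  Interpolation gives the remainder, and setting t = 0
   concludes. *)

From HB Require Import structures.
Require Import Defs.
From mathcomp Require Import all_boot all_order all_algebra.
From mathcomp Require Import boolp perm fraction generic_quotient qpoly qfpoly.
From mathcomp Require Import ring zify.

Set Implicit Arguments.
Unset Strict Implicit.
Unset Printing Implicit Defensive.

Import Order.TTheory GRing.Theory.

Local Open Scope ring_scope.

(** * Orders of series and integrality of the ring of power series *)

Section WeightedOrder.

Context (n : nat) (R : comNzRingType) (W : 'X_{1..n} -> nat).
Hypothesis WD : forall m1 m2, W (m1 + m2)%MM = (W m1 + W m2)%N.

Implicit Types f g : {mfps R[n]}.

(** The weight is kept general: the total degree gives the order with respect to (x), while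
    Weierstrass division needs a weight adapted to the divisor. *)
Definition wlow (c : nat) f := forall m, (W m < c)%N -> mfcoef f m = 0.

Lemma mfcoefD f g m : mfcoef (f + g) m = mfcoef f m + mfcoef g m.
Proof. by []. Qed.

Lemma mfcoefN f m : mfcoef (- f) m = - mfcoef f m.
Proof. by []. Qed.

Lemma mfcoefB f g m : mfcoef (f - g) m = mfcoef f m - mfcoef g m.
Proof. by []. Qed.

Lemma mfcoef_sum (I : Type) (r : seq I) (P : pred I) (F : I -> {mfps R[n]}) m :
  mfcoef (\sum_(i <- r | P i) F i) m = \sum_(i <- r | P i) mfcoef (F i) m.
Proof. exact: (big_morph (fun f : {mfps R[n]} => mfcoef f m)). Qed.

Lemma mfcoefM_eq0 f g m :
  (forall m1 m2, (m1 + m2)%MM = m -> mfcoef f m1 * mfcoef g m2 = 0) ->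
  mfcoef (f * g) m = 0.
Proof.
move=> fg0; change (mfcoef (mfps_mul f g) m = 0); rewrite /=.
by apply: big1 => k /eqP mk; apply: fg0.
Qed.

Lemma wlow_le c d f : (c <= d)%N -> wlow d f -> wlow c f.
Proof. by move=> cd fd m mc; apply: fd; apply: leq_trans cd. Qed.

Lemma wlowD c f g : wlow c f -> wlow c g -> wlow c (f + g).
Proof. by move=> fc gc m mc; rewrite mfcoefD fc // gc // addr0. Qed.

Lemma wlowN c f : wlow c f -> wlow c (- f).
Proof. by move=> fc m mc; rewrite mfcoefN fc // oppr0. Qed.

Lemma wlowB c f g : wlow c f -> wlow c g -> wlow c (f - g).
Proof. by move=> fc gc; apply: wlowD => //; apply: wlowN. Qed.

Lemma wlow_sum c (I : Type) (r : seq I) (P : pred I) (F : I -> {mfps R[n]}) :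
  (forall i, P i -> wlow c (F i)) -> wlow c (\sum_(i <- r | P i) F i).
Proof. by move=> Fc; elim/big_ind: _ => // f g; apply: wlowD. Qed.

Lemma wlowM c d f g : wlow c f -> wlow d g -> wlow (c + d) (f * g).
Proof.
move=> fc gd m mcd; apply: mfcoefM_eq0 => m1 m2 mE.
have [m1c|m1c] := ltnP (W m1) c; first by rewrite fc ?mul0r.
rewrite gd ?mulr0 //; move: mcd; rewrite -mE WD; lia.
Qed.

Lemma wlowMl c f g : wlow c f -> wlow c (g * f).
Proof. by move=> fc; rewrite -[c]add0n; apply: wlowM. Qed.

Lemma wlow_all_eq0 f : (forall c, wlow c f) -> f = 0.
Proof. by move=> f0; apply: mfpsP => m; apply: (f0 (W m).+1). Qed.

Lemma wlowX c f j : wlow c f -> wlow (c * j) (f ^+ j).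
Proof.
move=> fc; elim: j => [|j IH]; first by rewrite muln0.
by rewrite exprS mulnS; apply: wlowM.
Qed.

End WeightedOrder.

Local Notation low := (wlow (@mdeg _)).

Lemma wlow_leW n (R : comNzRingType) (V W : 'X_{1..n} -> nat) c
    (f : {mfps R[n]}) : (forall m, (V m <= W m)%N) -> wlow V c f -> wlow W c f.
Proof. by move=> VW fc m mc; apply: fc; apply: leq_ltn_trans (VW m) mc. Qed.

Section PolynomialsAsSeries.

Context (n : nat) (R : comNzRingType).
Implicit Types (f : {mfps R[n]}) (p : {mpoly R[n]}).

Lemma mfps_of_mpoly_inj : injective (@mfps_of_mpoly n R).
Proof.
move=> p q pq; apply/mpolyP => m.
by rewrite -[LHS]/(mfcoef (mfps_of_mpoly p) m) pq.
Qed.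

Lemma mfps_of_mpoly_eq0 p : (mfps_of_mpoly p == 0) = (p == 0).
Proof. by rewrite -[0 in LHS](rmorph0 (@mfps_of_mpoly n R)) (inj_eq mfps_of_mpoly_inj). Qed.

Lemma low_trunc b f : low b (f - mfps_of_mpoly (mfps_trunc b f)).
Proof. by move=> m mb; rewrite mfcoefB /= mcoeff_trunc // subrr. Qed.

Lemma mfcoefMX f (u m : 'X_{1..n}) :
  mfcoef (f * mfps_of_mpoly 'X_[u]) (m + u)%MM = mfcoef f m.
Proof.
change (mfcoef (mfps_mul f (mfps_of_mpoly 'X_[u])) (m + u)%MM = mfcoef f m).
rewrite (@mfcoefM_trunc _ _ (mdeg (m + u)).+1) //.
set b := (mdeg (m + u)).+1.
rewrite (@mcoeffM_low _ _ b _ _ (mfps_trunc b f) 'X_[u]) //; last first.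
  by move=> v vb; rewrite mcoeff_trunc.
by rewrite [in X in _@_X]addmC mcoeffMX mcoeff_trunc // /b mdegD ltnS leq_addr.
Qed.

Lemma mfcoefMX_eq0 f (u m : 'X_{1..n}) : ~~ (u <= m)%MM ->
  mfcoef (f * mfps_of_mpoly 'X_[u]) m = 0.
Proof.
move=> um; apply: mfcoefM_eq0 => m1 m2 mE; rewrite /= mcoeffX.
by case: eqP um => [->|_ _]; rewrite ?mulr0 // -mE lem_addl.
Qed.

Lemma mfcoefCM (c : R) f m : mfcoef (mfps_of_mpoly c%:MP * f) m = c * mfcoef f m.
Proof.
change (mfcoef (mfps_mul (mfps_of_mpoly c%:MP) f) m = c * mfcoef f m).
rewrite (@mfcoefM_trunc _ _ (mdeg m).+1) //.
rewrite (@mcoeffM_low _ _ (mdeg m).+1 _ _ c%:MP (mfps_trunc (mdeg m).+1 f)) //; last first.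
  by move=> v vb; rewrite mcoeff_trunc.
by rewrite mcoeffCM mcoeff_trunc.
Qed.

End PolynomialsAsSeries.

Section Domain.

Context (n : nat) (R : idomainType).
Implicit Types f g : {mfps R[n]}.

(** The support may be infinite, but the monomial order is well-founded. *)
Lemma mfps_min_monomial f : f != 0 ->
  exists2 m, mfcoef f m != 0 & forall m', (m' < m)%O -> mfcoef f m' = 0.
Proof.
move=> f0; have [m fm] : exists m, mfcoef f m != 0.
  apply: contrapT => nf; case/eqP: f0; apply: mfpsP => m.
  by apply/eqP; apply: contrapT => /negP fm; apply: nf; exists m.
elim/(well_founded_ind (@ltom_wf n)): m fm => m IH fm.
have [[m' [mm' fm']]|nex] := pselect (exists m', (m' < m)%O /\ mfcoef f m' != 0).
  exact: IH fm'.
exists m => // m' mm'; apply/eqP; apply: contrapT => /negP fm'.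
by apply: nex; exists m'.
Qed.

(** If k1 + k2 = m1 + m2 and k1 > m1, then k2 < m2, because the order is compatible with addition.
    Hence only the pair (m1, m2) contributes. *)
Lemma mfcoefM_min f g (m1 m2 : 'X_{1..n}) :
  (forall m', (m' < m1)%O -> mfcoef f m' = 0) ->
  (forall m', (m' < m2)%O -> mfcoef g m' = 0) ->
  mfcoef (f * g) (m1 + m2)%MM = mfcoef f m1 * mfcoef g m2.
Proof.
move=> fm gm; set m := (m1 + m2)%MM.
have b1 : (mdeg m1 < (mdeg m).+1)%N by rewrite ltnS /m mdegD leq_addr.
have b2 : (mdeg m2 < (mdeg m).+1)%N by rewrite ltnS /m mdegD leq_addl.
change (mfcoef (mfps_mul f g) m = mfcoef f m1 * mfcoef g m2); rewrite /=.
rewrite (bigD1 (BMultinom b1, BMultinom b2)) //= big1 ?addr0 // => -[k1 k2] /=.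
case/andP=> /eqP mE kne.
have [k1m|k1m|k1m] := ltgtP (k1 : 'X_{1..n}) m1.
- by rewrite fm ?mul0r.
- have k2m : ((k2 : 'X_{1..n}) < m2)%O.
    rewrite ltNge; apply/negP => k2m.
    by have := ltmc_le_add k1m k2m; rewrite -mE ltxx.
  by rewrite gm ?mulr0.
- case/negP: kne; apply/eqP; congr (_, _); apply: val_inj => //=.
  by apply: (@addmI _ m1); apply: etrans (congr1 (fun z => (z + k2)%MM) (esym k1m)) (esym mE).
Qed.

Lemma mfps_integral f g : f * g = 0 -> (f == 0) || (g == 0).
Proof.
move=> fg0; apply: contrapT => /negP; rewrite negb_or => /andP[f0 g0].
have [m1 f1 m1P] := mfps_min_monomial f0.
have [m2 g2 m2P] := mfps_min_monomial g0.
have := mfcoefM_min m1P m2P; rewrite fg0 => /esym/eqP.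
by rewrite mulf_eq0 (negPf f1) (negPf g2).
Qed.

(** Units and inverses are chosen classically; they complete the structure of an integral domain,
    whose fraction field is used later. *)
Definition mfps_unit : {pred {mfps R[n]}} := [pred f | `[< exists g, g * f = 1 >]].
Definition mfps_inv f : {mfps R[n]} :=
  if pselect (exists g, g * f = 1) is left ex then projT1 (cid ex) else f.

Let mulVf : {in mfps_unit, left_inverse 1 mfps_inv *%R}.
Proof.
move=> f /asboolP fu; rewrite /mfps_inv; case: pselect => // ex.
by case: (cid ex).
Qed.

Let unitP f g : g * f = 1 -> f \in mfps_unit.
Proof. by move=> gf; apply/asboolP; exists g. Qed.

Let inv_out : {in [predC mfps_unit], mfps_inv =1 id}.
Proof.
move=> f /negP fu; rewrite /mfps_inv; case: pselect => // ex.
by case: fu; apply/asboolP.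
Qed.

HB.instance Definition _ :=
  GRing.ComNzRing_hasMulInverse.Build {mfps R[n]} mulVf unitP inv_out.
HB.instance Definition _ :=
  GRing.ComUnitRing_isIntegral.Build {mfps R[n]} mfps_integral.

End Domain.

(** * Substitution of polynomials without constant term *)

Lemma mpoly_hom_ext (n : nat) (R S : comNzRingType)
    (phi psi : {rmorphism {mpoly R[n]} -> S}) :
  (forall c, phi c%:MP = psi c%:MP) -> (forall i, phi 'X_i = psi 'X_i) ->
  phi =1 psi.
Proof.
move=> eqC eqX p; rewrite [p]mpolyE !rmorph_sum; apply: eq_bigr => m _.
rewrite -mul_mpolyC !rmorphM eqC mpolyXE_id !rmorph_prod; congr (_ * _).
by apply: eq_bigr => i _; rewrite !rmorphXn eqX.
Qed.

Section Continuity.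

Context (n p : nat) (R : comNzRingType).

Definition low_continuous (phi : {mfps R[n]} -> {mfps R[p]}) :=
  forall b f, low b f -> low b (phi f).

(** Polynomials are dense and both maps are continuous, so the difference of the two values has
    every order. *)
Lemma mfps_hom_ext (phi psi : {additive {mfps R[n]} -> {mfps R[p]}}) :
  low_continuous phi -> low_continuous psi ->
  (forall q, phi (mfps_of_mpoly q) = psi (mfps_of_mpoly q)) -> phi =1 psi.
Proof.
move=> phiC psiC eq_pol f; apply/eqP; rewrite -subr_eq0; apply/eqP.
apply: (wlow_all_eq0 (W := @mdeg p)) => b.
set q := mfps_of_mpoly (mfps_trunc b f).
have -> : phi f - psi f = phi (f - q) - psi (f - q).
  by rewrite (raddfB phi) (raddfB psi) eq_pol opprB addrA subrK.
by apply: wlowB; [apply: phiC|apply: psiC]; apply: low_trunc.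
Qed.

End Continuity.

Section Substitution.

Context (n p : nat) (R : comNzRingType).

Record zsubst :=
  ZSubst { zsubst_fun :> 'I_n -> {mpoly R[p]};
           _ : forall i, (zsubst_fun i)@_0%MM = 0 }.

Variable y : zsubst.

Local Notation psub := (mmap (@mpolyC p R) y).

Lemma zsubst_low i : low 1 (mfps_of_mpoly (y i)).
Proof.
case: y => z z0 m /=; rewrite ltnS leqn0 mdeg_eq0 => /eqP ->; exact: z0.
Qed.

Lemma low_prod (I : Type) (r : seq I) (F : I -> {mfps R[p]}) (c : I -> nat) :
  (forall i, low (c i) (F i)) -> low (\sum_(i <- r) c i) (\prod_(i <- r) F i).
Proof.
move=> Fc; elim: r => [|i r IH]; first by rewrite !big_nil.
by rewrite !big_cons; apply: wlowM => //; apply: mdegD.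
Qed.

(** A monomial of degree e goes to a product of e factors without constant term, so substitution
    does not lower the order. *)
Lemma low_psub b q : low b (mfps_of_mpoly q) -> low b (mfps_of_mpoly (psub q)).
Proof.
move=> qb; rewrite /mmap raddf_sum big_seq; apply: wlow_sum => m mq.
rewrite /= rmorphM; apply: wlowMl; first exact: mdegD.
apply: (@wlow_le _ _ _ _ (mdeg m)).
  rewrite leqNgt; apply/negP => mb; have /eqP := qb m mb.
  by rewrite /= mcoeff_eq0 mq.
rewrite /mmap1 rmorph_prod mdegE; apply: low_prod => i.
rewrite rmorphXn -[X in low X _]mul1n; apply: wlowX; first exact: mdegD.
exact: zsubst_low.
Qed.

(** By [low_psub], terms of f of degree larger than that of u do not contribute to the coefficient
    of u, so a finite truncation suffices. *)
Definition msubst (f : {mfps R[n]}) : {mfps R[p]} :=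
  MFPS (fun u => (psub (mfps_trunc (mdeg u).+1 f))@_u).

Lemma msubst_approx b f q :
  low b (f - mfps_of_mpoly q) -> low b (msubst f - mfps_of_mpoly (psub q)).
Proof.
move=> fq u ub; rewrite mfcoefB /= -mcoeffB -rmorphB /=.
apply: (@low_psub (mdeg u).+1) => // m mu.
rewrite /= mcoeffB mcoeff_trunc //; apply: fq.
exact: leq_trans mu ub.
Qed.

Lemma msubst_mpoly q : msubst (mfps_of_mpoly q) = mfps_of_mpoly (psub q).
Proof.
apply/eqP; rewrite -subr_eq0; apply/eqP.
apply: (wlow_all_eq0 (W := @mdeg p)) => b; apply: msubst_approx.
by rewrite subrr.
Qed.

Let approx b f := @msubst_approx b _ _ (@low_trunc n R b f).

(** Telescoping identities that reduce additivity and multiplicativity of [msubst] to polynomial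
    approximations. *)
Let subB_approx (S : comNzRingType) (a b c q r : S) :
  a - (b - c) = (a - (q - r)) - (b - q) + (c - r).
Proof. by ring. Qed.

Let subM_approx (S : comNzRingType) (a b c q r : S) :
  a - b * c = (a - q * r) - (r * (b - q) + b * (c - r)).
Proof. by ring. Qed.

Let substB : zmod_morphism msubst.
Proof.
move=> f g; apply/eqP; rewrite -subr_eq0; apply/eqP.
apply: (wlow_all_eq0 (W := @mdeg p)) => b.
set q := mfps_trunc b f; set r := mfps_trunc b g.
rewrite (subB_approx _ _ _ (mfps_of_mpoly (psub q)) (mfps_of_mpoly (psub r))).
apply: wlowD; last exact: approx.
apply: wlowB; last exact: approx.
rewrite -!rmorphB; apply: msubst_approx; rewrite rmorphB.
(* The same identity, now read before substitution, shows that q - r approximates f - g. *)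
have := subB_approx (f - g) f g (mfps_of_mpoly q) (mfps_of_mpoly r).
rewrite subrr -addrA => /esym/eqP; rewrite addr_eq0 => /eqP ->.
by rewrite opprD opprK; apply: wlowB; apply: low_trunc.
Qed.

HB.instance Definition _ :=
  GRing.isZmodMorphism.Build {mfps R[n]} {mfps R[p]} msubst substB.

Lemma low_msubst : low_continuous msubst.
Proof.
move=> b f fb; have -> : msubst f = msubst f - mfps_of_mpoly (psub 0).
  by rewrite !rmorph0 subr0.
by apply: msubst_approx; rewrite rmorph0 subr0.
Qed.

Let substM : monoid_morphism msubst.
Proof.
split=> [|f g].
  by rewrite -(rmorph1 (@mfps_of_mpoly n R)) msubst_mpoly !rmorph1.
apply/eqP; rewrite -subr_eq0; apply/eqP.
apply: (wlow_all_eq0 (W := @mdeg p)) => b.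
set q := mfps_trunc b f; set r := mfps_trunc b g.
rewrite (subM_approx _ _ _ (mfps_of_mpoly (psub q)) (mfps_of_mpoly (psub r))).
apply: wlowB; last first.
  by apply: wlowD; apply: wlowMl; [exact: mdegD|exact: approx|exact: mdegD|exact: approx].
rewrite -!rmorphM; apply: msubst_approx; rewrite rmorphM.
have := subM_approx (f * g) f g (mfps_of_mpoly q) (mfps_of_mpoly r).
rewrite subrr => /esym/eqP; rewrite subr_eq0 => /eqP ->.
by apply: wlowD; apply: wlowMl; [exact: mdegD|exact: low_trunc|exact: mdegD|exact: low_trunc].
Qed.

HB.instance Definition _ :=
  GRing.isMonoidMorphism.Build {mfps R[n]} {mfps R[p]} msubst substM.

Lemma msubstC c : msubst (mfps_of_mpoly c%:MP) = mfps_of_mpoly c%:MP.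
Proof. by rewrite msubst_mpoly mmapC. Qed.

Lemma msubstX i : msubst (mfps_of_mpoly 'X_i) = mfps_of_mpoly (y i).
Proof. by rewrite msubst_mpoly mmapX mmap1U. Qed.

End Substitution.

(** By density of the polynomials, it suffices to compare the values on the variables. *)
Lemma msubst_comp_ext (n p q : nat) (R : comNzRingType)
    (y : zsubst n p R) (z : zsubst p q R) (t : zsubst n q R) :
  (forall i, mmap (@mpolyC q R) z (y i) = t i) ->
  forall f, msubst z (msubst y f) = msubst t f.
Proof.
move=> yzt f; apply: (@mfps_hom_ext n q R (msubst z \o msubst y) (msubst t)).
- by move=> b g gb; apply: low_msubst; apply: low_msubst.
- exact: low_msubst.
- move=> g /=; rewrite !msubst_mpoly; congr mfps_of_mpoly.
  apply: (@mpoly_hom_ext n R _ (mmap (@mpolyC q R) z \o mmap (@mpolyC p R) y)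
    (mmap (@mpolyC q R) t)) => [c|i] /=; first by rewrite !mmapC.
  by rewrite !mmapX !mmap1U.
Qed.

Lemma msubst_id (n : nat) (R : comNzRingType) (y : zsubst n n R) :
  (forall i, y i = 'X_i) -> forall f, msubst y f = f.
Proof.
move=> yX f; apply: (@mfps_hom_ext n n R (msubst y) idfun) => //.
- exact: low_msubst.
- move=> g /=; rewrite msubst_mpoly; congr mfps_of_mpoly.
  apply: (@mpoly_hom_ext n R _ (mmap (@mpolyC n R) y) idfun) => [c|i] /=.
    by rewrite mmapC.
  by rewrite mmapX mmap1U.
Qed.

Section InsertDelete.

Context (n : nat) (R : comNzRingType) (h : 'I_n.+1).

(** [zins] gives the embedding onto the series not involving x_h, and [zdel] its retraction x_h =
    0. *)
Definition zins : zsubst n n.+1 R.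
Proof.
exists (fun i => 'X_(lift h i)) => i.
by rewrite mcoeffX mnm1_eq0.
Defined.

Definition zdel : zsubst n.+1 n R.
Proof.
exists (fun i => if unlift h i is Some j then 'X_j else 0) => i.
by case: unlift => [j|]; rewrite ?mcoeff0 // mcoeffX mnm1_eq0.
Defined.

Lemma zinsK f : msubst zdel (msubst zins f) = f.
Proof.
have y0 i : ('X_i : {mpoly R[n]})@_0%MM = 0 by rewrite mcoeffX mnm1_eq0.
rewrite (@msubst_comp_ext _ _ _ _ _ _ (ZSubst y0)) ?msubst_id // => i.
by rewrite /= mmapX mmap1U /= liftK.
Qed.

Lemma zdel_X : msubst zdel (mfps_of_mpoly 'X_h) = 0.
Proof. by rewrite msubstX /= unlift_none rmorph0. Qed.

End InsertDelete.

(** * Expansion in the last variable *)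

Section LastVariable.

Context (n : nat) (R : comNzRingType).

Local Notation wid := (msubst (zins R (@ord_max n))).
Local Notation X := (mfps_of_mpoly ('X_ord_max : {mpoly R[n.+1]})).
Implicit Types (m : 'X_{1..n.+1}) (g : {mfps R[n]}) (f : {mfps R[n.+1]}).

Definition mrest m : 'X_{1..n} := [multinom m (lift ord_max i) | i < n].

Definition mext (m' : 'X_{1..n}) (j : nat) : 'X_{1..n.+1} :=
  (mnmwiden m' + U_(ord_max) *+ j)%MM.

Lemma lift_max_widen (i : 'I_n) : lift ord_max i = widen_ord (leqnSn n) i.
Proof. by apply: val_inj; exact: lift_max. Qed.

Lemma mrestD m1 m2 : mrest (m1 + m2) = (mrest m1 + mrest m2)%MM.
Proof. by apply/mnmP => i; rewrite mnmDE !mnmE. Qed.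

Lemma mrest_wid (m' : 'X_{1..n}) : mrest (mnmwiden m') = m'.
Proof. by apply/mnmP => i; rewrite mnmE lift_max_widen mnmwiden_widen. Qed.

Lemma mrest_max j : mrest (U_(ord_max) *+ j)%MM = 0%MM.
Proof.
apply/mnmP => i; rewrite mnmE mnm0E mulmnE mnm1E.
by rewrite (negPf (neq_lift _ _)) mul0n.
Qed.

Lemma mrest_ext (m' : 'X_{1..n}) j : mrest (mext m' j) = m'.
Proof. by rewrite mrestD mrest_wid mrest_max addm0. Qed.

Lemma mext_max (m' : 'X_{1..n}) j : mext m' j ord_max = j.
Proof. by rewrite mnmDE mnmwiden_ordmax mulmnE mnm1E eqxx mul1n. Qed.

Lemma mext_rest m : mext (mrest m) (m ord_max) = m.
Proof.
apply/mnmP => i; case: (unliftP ord_max i) => [j|] ->; last exact: mext_max.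
rewrite mnmDE mulmnE mnm1E (negPf (neq_lift _ _)) addn0.
by rewrite lift_max_widen mnmwiden_widen mnmE lift_max_widen.
Qed.

Lemma mdeg_rest m : mdeg m = (mdeg (mrest m) + m ord_max)%N.
Proof.
rewrite !mdegE big_ord_recr /=; congr addn.
by apply: eq_bigr => i _; rewrite mnmE lift_max_widen.
Qed.

(** A coefficientwise description of [wid], which is itself defined by substitution; [widE]
    identifies the two by continuity. *)
Definition mfps_inc g : {mfps R[n.+1]} :=
  MFPS (fun m => if m ord_max == 0%N then mfcoef g (mrest m) else 0).

Let incB : zmod_morphism mfps_inc.
Proof.
by move=> f g; apply: mfpsP => m /=; case: eqP => _; rewrite ?mfcoefB //= subr0.
Qed.

HB.instance Definition _ :=
  GRing.isZmodMorphism.Build {mfps R[n]} {mfps R[n.+1]} mfps_inc incB.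

Lemma widE g : wid g = mfps_inc g.
Proof.
apply: (@mfps_hom_ext n n.+1 R wid mfps_inc); first exact: low_msubst.
  move=> b f fb m mb /=; case: eqP => // m0; apply: fb.
  by move: mb; rewrite mdeg_rest m0 addn0.
move=> q; transitivity (mfps_of_mpoly (mmap (@mpolyC n.+1 R) (zins R ord_max) q)).
  exact: msubst_mpoly.
apply: mfpsP => m.
change ((mmap (@mpolyC n.+1 R) (zins R ord_max) q)@_m =
  if m ord_max == 0%N then q@_(mrest m) else 0).
rewrite /mmap raddf_sum /=.
have E (v : 'X_{1..n}) :
    mmap1 (fun i : 'I_n => ('X_(lift ord_max i) : {mpoly R[n.+1]})) v
      = 'X_[mnmwiden v].
  rewrite -mwidenX /mwiden mmapX; apply: mmap1_eq => i.
  by rewrite lift_max_widen.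
case: eqP => [m0|mN0].
  rewrite [in RHS](mpolyE q) [in RHS]raddf_sum; apply: eq_bigr => v _ /=.
  rewrite E mcoeffCM mcoeffX mcoeffZ mcoeffX; congr (_ * (nat_of_bool _)%:R).
  apply/eqP/eqP => [<-|->]; first by rewrite mrest_wid.
  by rewrite -[in RHS](mext_rest m) m0 /mext mulm0n addm0.
apply: big1 => v _; rewrite E mcoeffCM mcoeffX; case: eqP => [vm|]; last by rewrite mulr0.
by case: mN0; rewrite -vm mnmwiden_ordmax.
Qed.

Lemma coef_widX g j m :
  mfcoef (wid g * X ^+ j) m = if m ord_max == j then mfcoef g (mrest m) else 0.
Proof.
rewrite -rmorphXn mpolyXn.
have [jm|jm] := leqP j (m ord_max); last first.
  rewrite ltn_eqF // mfcoefMX_eq0 //; apply/negP => /mnm_lepP /(_ ord_max).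
  by rewrite mulmnE mnm1E eqxx mul1n leqNgt jm.
have mE : (mext (mrest m) (m ord_max - j) + U_(ord_max) *+ j)%MM = m.
  rewrite -[in RHS](mext_rest m) /mext -addmA; congr (_ + _)%MM.
  by apply/mnmP => i; rewrite mnmDE !mulmnE -mulnDr subnK.
rewrite -[in LHS]mE mfcoefMX widE /= mrest_ext mext_max.
by rewrite subn_eq0 eqn_leq jm andbT.
Qed.

Definition xcoef (j : nat) f : {mfps R[n]} := MFPS (fun v : 'X_{1..n} => mfcoef f (mext v j)).

(** The embedding of R[[x']][X] into R[[x', X]]. *)
Definition pser (p : {poly {mfps R[n]}}) : {mfps R[n.+1]} := (map_poly wid p).[X].

Lemma pser_is_zmod : zmod_morphism pser.
Proof. by move=> p q; rewrite /pser rmorphB hornerD hornerN. Qed.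

HB.instance Definition _ :=
  GRing.isZmodMorphism.Build {poly {mfps R[n]}} {mfps R[n.+1]} pser pser_is_zmod.

Lemma pser_is_monoid : monoid_morphism pser.
Proof. by split=> [|p q]; rewrite /pser ?rmorph1 ?hornerC // rmorphM hornerM. Qed.

HB.instance Definition _ :=
  GRing.isMonoidMorphism.Build {poly {mfps R[n]}} {mfps R[n.+1]} pser pser_is_monoid.

Lemma pserC (c : {mfps R[n]}) : pser c%:P = wid c.
Proof. by rewrite /pser map_polyC hornerC. Qed.

Lemma pserX : pser 'X = X.
Proof. by rewrite /pser map_polyX hornerX. Qed.

Lemma pser_MXaddC (p : {poly {mfps R[n]}}) c :
  pser (p * 'X + c%:P) = pser p * X + wid c.
Proof. by rewrite rmorphD rmorphM /= pserX pserC. Qed.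

Lemma pserE a (p : {poly {mfps R[n]}}) : (size p <= a)%N -> pser p = \sum_(j < a) wid p`_j * X ^+ j.
Proof.
move=> pa; rewrite /pser (@horner_coef_wide _ a); last exact: leq_trans (size_poly _ _) pa.
by apply: eq_bigr => i _; rewrite coef_map.
Qed.

Lemma mfcoef_pser (p : {poly {mfps R[n]}}) m : mfcoef (pser p) m = mfcoef p`_(m ord_max) (mrest m).
Proof.
pose a := maxn (size p) (m ord_max).+1.
rewrite (@pserE a) ?leq_maxl // mfcoef_sum.
have ma : (m ord_max < a)%N by rewrite leq_maxr.
rewrite (bigD1 (Ordinal ma)) // coef_widX eqxx big1 => [|j jm]; first exact: addr0.
rewrite coef_widX; case: eqP => // mj; case/eqP: jm; apply: val_inj.
by rewrite /= mj.
Qed.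

Lemma pser_inj : injective pser.
Proof.
move=> p q pq; apply/polyP => j; apply: mfpsP => v.
by have := mfcoef_pser p (mext v j); rewrite pq mfcoef_pser mext_max mrest_ext.
Qed.

Lemma pser_xcoef a f : (forall m, (a <= m ord_max)%N -> mfcoef f m = 0) ->
  pser (\poly_(j < a) xcoef j f) = f.
Proof.
move=> fa; apply: mfpsP => m; rewrite mfcoef_pser coef_poly.
case: ltnP => ma; last by rewrite fa.
by rewrite /= mext_rest.
Qed.

End LastVariable.

Local Notation mwid := (msubst (zins _ (@ord_max _))).
Local Notation lastX := (mfps_of_mpoly 'X_ord_max).

(** * Weierstrass division *)

Section Weierstrass.

Context (n : nat) (k : fieldType) (a : nat) (h : {mfps k[n.+1]}).

(** In Weierstrass terms: h(0, X) has order exactly a. *)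
Definition xregular :=
  (forall j, (j < a)%N -> mfcoef h (mext 0%MM j) = 0) /\
  mfcoef h (mext 0%MM a) != 0.

Hypothesis h_reg : xregular.

Implicit Types (f g Q : {mfps k[n.+1]}) (m : 'X_{1..n.+1}).

(* With this weight, h is u X^a plus terms of weight > a, so that the division
   step is a contraction. *)
Definition xwt m := (a.+1 * mdeg (mrest m) + m ord_max)%N.

Lemma xwtD m1 m2 : xwt (m1 + m2)%MM = (xwt m1 + xwt m2)%N.
Proof. by rewrite /xwt mrestD mdegD mnmDE; lia. Qed.

Local Notation wl := (wlow xwt).
Let u := mfcoef h (mext 0%MM a).
Let uXa : {mfps k[n.+1]} := mfps_of_mpoly u%:MP * lastX ^+ a.
Let h' := h - uXa.

Let uXaE : uXa = pser ((mfps_of_mpoly u%:MP)%:P * 'X^a).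
Proof. by rewrite rmorphM rmorphXn /= pserC pserX msubstC. Qed.

Let coef_uXa m :
  mfcoef uXa m = if m == mext 0%MM a then u else 0.
Proof.
rewrite uXaE mfcoef_pser coefCM coefXn.
case: (m =P mext 0%MM a) => [->|mN].
  by rewrite mext_max eqxx mulr1 mrest_ext /= mcoeffC eqxx mulr1.
case: (m ord_max =P a) => [ma|_]; last by rewrite mulr0.
rewrite mulr1 /= mcoeffC; case: eqP => [r0|]; last by rewrite mulr0.
by case: mN; rewrite -r0 -ma mext_rest.
Qed.

Lemma wlow_xregular : wl a h.
Proof.
move=> m ma; have r0 : mrest m = 0%MM.
  apply/eqP; rewrite -mdeg_eq0; case: (mdeg _ =P 0)%N => // /eqP r0.
  move: ma; rewrite /xwt -lt0n in r0 *; nia.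
rewrite -(mext_rest m) r0; apply: h_reg.1.
by move: ma; rewrite /xwt r0 mdeg0 muln0 add0n.
Qed.

Let wlow_h' : wl a.+1 h'.
Proof.
move=> m ma; rewrite mfcoefB coef_uXa; case: eqP => [->|mN]; first exact: subrr.
rewrite subr0; have [am|am] := ltnP (xwt m) a; first exact: wlow_xregular.
have r0 : mrest m = 0%MM.
  apply/eqP; rewrite -mdeg_eq0; case: (mdeg _ =P 0)%N => // /eqP r0.
  move: ma am; rewrite /xwt -lt0n in r0 *; nia.
case: mN; rewrite -(mext_rest m) r0; congr (mext _ _).
by move: ma am; rewrite /xwt r0 mdeg0 muln0 add0n; lia.
Qed.

(** Division by the leading term u X^a, after dropping the monomials that X^a does not divide. *)
Let D g := MFPS (fun m => u^-1 * mfcoef g (m + U_(ord_max) *+ a)%MM).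

Let DB f g : D (f - g) = D f - D g.
Proof. by apply: mfpsP => m; rewrite mfcoefB /= mulrBr. Qed.

Let xwt_maxn j : xwt (U_(ord_max) *+ j)%MM = j.
Proof. by rewrite /xwt mrest_max mdeg0 muln0 add0n mulmnE mnm1E eqxx mul1n. Qed.

Let wlow_D c g : wl (c + a) g -> wl c (D g).
Proof.
by move=> gc m mc; rewrite /= gc ?mulr0 // xwtD xwt_maxn ltn_add2r.
Qed.

Let small f := forall m, (a <= m ord_max)%N -> mfcoef f m = 0.

Let smallDE g : small (g - uXa * D g).
Proof.
move=> m am; have mE : (m - U_(ord_max) *+ a + U_(ord_max) *+ a)%MM = m.
  apply: submK; apply/mnm_lepP => i; rewrite mulmnE mnm1E.
  by case: eqP => [<-|_]; rewrite ?mul1n ?mul0n.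
have -> : uXa * D g = (mfps_of_mpoly u%:MP * D g) * mfps_of_mpoly 'X_[U_(ord_max) *+ a].
  by rewrite -mpolyXn rmorphXn; rewrite /uXa -!mulrA; congr (_ * _); rewrite mulrC.
rewrite mfcoefB -[in X in _ - X]mE mfcoefMX mfcoefCM.
by rewrite /= mE mulrA divff ?mul1r ?subrr // h_reg.2.
Qed.

Let small_D f : small f -> D f = 0.
Proof.
move=> fs; apply: mfpsP => m /=; rewrite fs ?mulr0 //.
by rewrite mnmDE mulmnE mnm1E eqxx mul1n leq_addl.
Qed.

Let D_uXa f : D (uXa * f) = f.
Proof.
apply/eqP; rewrite -subr_eq0; apply/eqP; apply: mfpsP => m.
have := smallDE (uXa * f) (m := (m + U_(ord_max) *+ a)%MM).
rewrite -mulrBr mnmDE mulmnE mnm1E eqxx mul1n leq_addl => /(_ isT).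
rewrite -mulrA [lastX ^+ a * _]mulrC -rmorphXn mpolyXn mulrA mfcoefMX mfcoefCM.
move/eqP; rewrite mulf_eq0 (negPf h_reg.2) orFb => /eqP fD0.
by rewrite -opprB mfcoefN fD0 oppr0.
Qed.

(** The fixed points are the Weierstrass quotients of f. Multiplication by h' raises the weight by
    at least a + 1 and D lowers it by at most a, so the map is a contraction. *)
Let step f Q := D (f - h' * Q).

Let step_contract f Q1 Q2 i : wl i (Q1 - Q2) -> wl i.+1 (step f Q1 - step f Q2).
Proof.
move=> Qi; rewrite /step -DB; apply: wlow_D.
have -> : f - h' * Q1 - (f - h' * Q2) = - (h' * (Q1 - Q2)).
  by rewrite mulrBr opprB opprB addrC addrA subrK.
by apply: wlowN; rewrite addSnnS addnC; apply: wlowM => //; apply: xwtD.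
Qed.

Let fixstep f Q : Q = step f Q -> small (f - h * Q).
Proof.
move=> QE; have -> : f - h * Q = (f - h' * Q) - uXa * D (f - h' * Q).
  by rewrite -[D _]QE /h' mulrBl opprB addrA addrAC addrK.
exact: smallDE.
Qed.

Lemma weierstrass_small f : exists Q, small (f - h * Q).
Proof.
pose Qs i := iter i (step f) 0.
have Qs1 i : wl i (Qs i.+1 - Qs i).
  by elim: i => [//|i IH]; apply: step_contract.
have Qsd i d : wl i (Qs (d + i)%N - Qs i).
  elim: d => [|d IH]; first by rewrite add0n subrr.
  rewrite addSn -(subrK (Qs (d + i)%N) (Qs _.+1)) -addrA.
  by apply: wlowD IH; apply: wlow_le (Qs1 _); rewrite leq_addl.
(* The limit of the iterates: the coefficient at m is constant from the index [xwt m] + 1 on. *)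
pose Q := MFPS (fun m => mfcoef (Qs (xwt m).+1) m).
have QQs i : wl i (Q - Qs i).
  move=> m mi; change (mfcoef (Qs (xwt m).+1) m - mfcoef (Qs i) m = 0).
  rewrite -(subnK mi) -mfcoefB -opprB mfcoefN.
  by rewrite (Qsd (xwt m).+1) ?oppr0.
exists Q; apply: fixstep; apply/eqP; rewrite -subr_eq0; apply/eqP.
apply: (wlow_all_eq0 (W := xwt)) => i.
have -> : Q - step f Q = (Q - Qs i.+1) - (step f Q - step f (Qs i)).
  by rewrite opprB addrA subrK.
by apply: wlowB; apply: (@wlow_le _ _ _ i i.+1) => //; apply: step_contract.
Qed.

(** The quotient is a fixed point of [step f]; using this equation repeatedly raises its weight up
    to c - a, and the product with h then has weight at least c. *)
Lemma weierstrass_wlow f Q c : small (f - h * Q) -> wl c f -> wl c (f - h * Q).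
Proof.
move=> fQs fc.
have QE : Q = step f Q.
  apply/eqP; rewrite -subr_eq0; apply/eqP.
  have := small_D fQs.
  have -> : f - h * Q = f - h' * Q - uXa * Q.
    by rewrite /h' mulrBl opprB addrA addrAC addrK.
  by rewrite DB D_uXa => /eqP; rewrite subr_eq0 => /eqP; rewrite /step => ->; rewrite subrr.
have Qi i : (i <= c - a)%N -> wl i Q.
  elim: i => [//|i IH] ic; rewrite QE; apply: wlow_D; apply: wlowB.
    by apply: wlow_le fc; lia.
  rewrite addSnnS addnC; apply: wlowM => //; first exact: xwtD.
  by apply: IH; lia.
apply: wlowB => //; apply: (@wlow_le _ _ _ _ (a + (c - a))); first by lia.
by apply: wlowM; [exact: xwtD|exact: wlow_xregular|exact: Qi].
Qed.

(** Division of 0: the remainder has weight at least c for every c. *)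
Lemma weierstrass_uniq (p : {poly {mfps k[n]}}) Q :
  (size p <= a)%N -> h * Q = pser p -> p = 0.
Proof.
move=> pa hQp; apply: pser_inj; rewrite rmorph0.
have s0 : small (0 - h * Q).
  move=> m am; rewrite sub0r mfcoefN hQp mfcoef_pser nth_default ?oppr0 //.
  exact: leq_trans pa am.
have -> : pser p = - (0 - h * Q) by rewrite sub0r opprK hQp.
apply: (wlow_all_eq0 (W := xwt)) => c; apply: wlowN.
exact: weierstrass_wlow.
Qed.

Lemma weierstrass f :
  exists p : {poly {mfps k[n]}},
    (size p <= a)%N /\ exists Q, f = h * Q + pser p.
Proof.
have [Q fQ] := weierstrass_small f.
exists (\poly_(j < a) xcoef j (f - h * Q)); split; first exact: size_poly.
by exists Q; rewrite pser_xcoef // addrC subrK.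
Qed.

Lemma weierstrass_rem_wlow f Q c (p : {poly {mfps k[n]}}) :
  (size p <= a)%N -> f = h * Q + pser p -> wl c f -> wl c (pser p).
Proof.
move=> pa fE fc; have -> : pser p = f - h * Q by rewrite fE addrAC subrr add0r.
apply: weierstrass_wlow => // m am.
rewrite fE addrAC subrr add0r mfcoef_pser nth_default //.
exact: leq_trans pa am.
Qed.

Definition wrem f : {poly {mfps k[n]}} := projT1 (cid (weierstrass f)).

Lemma size_wrem f : (size (wrem f) <= a)%N.
Proof. by rewrite /wrem; case: cid => p []. Qed.

Lemma wremP f : exists Q, f = h * Q + pser (wrem f).
Proof. by rewrite /wrem; case: cid => p []. Qed.

Lemma wrem_eq f Q (p : {poly {mfps k[n]}}) :
  (size p <= a)%N -> f = h * Q + pser p -> wrem f = p.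
Proof.
move=> pa fE; have [Q' fE'] := wremP f.
apply/eqP; rewrite -subr_eq0; apply/eqP.
apply: (@weierstrass_uniq _ (Q - Q')).
  by rewrite (leq_trans (size_polyD _ _)) // size_polyN geq_max size_wrem.
apply/eqP; rewrite rmorphB mulrBr subr_eq addrAC eq_sym subr_eq.
by rewrite [X in X == _]addrC -fE' fE.
Qed.

Lemma wrem_pser (p : {poly {mfps k[n]}}) : (size p <= a)%N -> wrem (pser p) = p.
Proof. by move=> pa; apply: (@wrem_eq _ 0) => //; rewrite mulr0 add0r. Qed.

Lemma wrem_mulh Q : wrem (h * Q) = 0.
Proof. by apply: (@wrem_eq _ Q); rewrite ?size_poly0 // rmorph0 addr0. Qed.

Lemma wrem_is_zmod : zmod_morphism wrem.
Proof.
move=> f g; have [Qf fE] := wremP f; have [Qg gE] := wremP g.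
apply: (@wrem_eq _ (Qf - Qg)).
  by rewrite (leq_trans (size_polyD _ _)) // size_polyN geq_max !size_wrem.
by rewrite rmorphB mulrBr /= {1}fE {1}gE opprD addrACA.
Qed.

HB.instance Definition _ :=
  GRing.isZmodMorphism.Build {mfps k[n.+1]} {poly {mfps k[n]}} wrem wrem_is_zmod.

Lemma wrem_mulr f g : wrem (f * g) = wrem (pser (wrem f) * g).
Proof.
have [Q fE] := wremP f; rewrite {1}fE mulrDl raddfD /= -mulrA wrem_mulh.
by rewrite add0r.
Qed.

Lemma wrem_wid (c : {mfps k[n]}) f : wrem (mwid c * f) = c *: wrem f.
Proof.
have [Q fE] := wremP f; apply: (@wrem_eq _ (mwid c * Q)).
  by rewrite (leq_trans (size_scale_leq _ _)) ?size_wrem.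
by rewrite -mul_polyC rmorphM /= pserC mulrCA -mulrDr -fE.
Qed.

End Weierstrass.

(** * Algebraic elements over a domain and splitting fields *)

Section FractionField.

Context (R : idomainType) (F : fieldType) (phi : {rmorphism R -> F}).
Hypothesis phi_inj : injective phi.

Local Notation "x %:F" := (FracField.tofrac x) (at level 1, format "x %:F").

Lemma fraction_repr (x : {fraction R}) :
  x = (\n_(repr x))%:F / (\d_(repr x))%:F.
Proof.
rewrite -{1}[x]reprK; unlock FracField.tofrac.
rewrite -[X in _ = _ * X]FracField.pi_inv -[RHS]FracField.pi_mul.
rewrite /FracField.mulf /FracField.invf !numden_Ratio ?oner_neq0 ?denom_ratioP //.
by rewrite mulr1 mul1r Ratio_numden.
Qed.

Lemma fraction_numden (x : {fraction R}) :
  exists2 nd : R * R, nd.2 != 0 & x = nd.1%:F / nd.2%:F.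
Proof.
exists (\n_(repr x), \d_(repr x)); first exact: denom_ratioP.
exact: fraction_repr.
Qed.

Definition frac_map (x : {fraction R}) : F := phi \n_(repr x) / phi \d_(repr x).

Let phi_neq0 x : x != 0 -> phi x != 0.
Proof. by rewrite -(rmorph0 phi) (inj_eq phi_inj). Qed.

Lemma frac_map_div n d : d != 0 -> frac_map (n%:F / d%:F) = phi n / phi d.
Proof.
move=> d0; rewrite /frac_map; set x : {fraction R} := n%:F / d%:F.
have [r0 r1] : phi \d_(repr x) != 0 /\ phi d != 0.
  by split; apply: phi_neq0 => //; apply: denom_ratioP.
apply/eqP; rewrite eqr_div // -!rmorphM (inj_eq phi_inj) -tofrac_eq !tofracM.
have -> : n%:F = x * d%:F by rewrite divfK // tofrac_eq0.
have -> : (\n_(repr x))%:F = x * (\d_(repr x))%:F.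
  by rewrite {2}[x]fraction_repr divfK // tofrac_eq0 denom_ratioP.
by rewrite mulrAC.
Qed.

Lemma frac_map_tofrac x : frac_map x%:F = phi x.
Proof.
by rewrite -[x%:F]divr1 -tofrac1 frac_map_div ?oner_neq0 // rmorph1 divr1.
Qed.

Lemma frac_map_is_zmod : zmod_morphism frac_map.
Proof.
move=> x y; have [[n d] /= d0 ->] := fraction_numden x.
have [[n' d'] /= d'0 ->] := fraction_numden y.
have -> : n%:F / d%:F - n'%:F / d'%:F = (n * d' - n' * d)%:F / (d * d')%:F.
  by rewrite tofracB !tofracM -mulNr addf_div ?tofrac_eq0 // mulNr.
rewrite !frac_map_div ?mulf_neq0 // rmorphB !rmorphM -[in RHS]mulNr.
by rewrite [RHS]addf_div ?phi_neq0 // mulNr.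
Qed.

Lemma frac_map_is_monoid : monoid_morphism frac_map.
Proof.
split=> [|x y]; first by rewrite -tofrac1 frac_map_tofrac rmorph1.
have [[n d] /= d0 ->] := fraction_numden x.
have [[n' d'] /= d'0 ->] := fraction_numden y.
by rewrite mulf_div -!tofracM !frac_map_div ?mulf_neq0 // !rmorphM mulf_div.
Qed.

HB.instance Definition _ :=
  GRing.isZmodMorphism.Build {fraction R} F frac_map frac_map_is_zmod.
HB.instance Definition _ :=
  GRing.isMonoidMorphism.Build {fraction R} F frac_map frac_map_is_monoid.

Lemma clear_denominators (p : {poly {fraction R}}) :
  exists2 d, d != 0 & exists P : {poly R}, d%:F *: p = map_poly (@FracField.tofrac R) P.
Proof.
elim/poly_ind: p => [|p c [d d0 [P PE]]].
  by exists 1; rewrite ?oner_neq0 //; exists 0; rewrite scaler0 rmorph0.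
have [[n e] /= e0 ->] := fraction_numden c.
exists (d * e); first by rewrite mulf_neq0.
exists (e%:P * P * 'X + (d * n)%:P).
rewrite tofracM rmorphD !rmorphM /= map_polyX !map_polyC /= -PE scalerDr.
congr (_ + _); first by rewrite mul_polyC scalerA -scalerAl [e%:F * _]mulrC.
rewrite -mul_polyC -polyCM -?polyCM; congr (_ %:P).
by rewrite ?tofracM -mulrA; congr (_ * _); rewrite mulrC divfK // tofrac_eq0.
Qed.

(** Algebraicity over the domain R. After clearing denominators it agrees with algebraicity over the
    fraction field, whose closure properties then apply. *)
Definition alg_over (u : F) := exists2 P : {poly R}, P != 0 & root (map_poly phi P) u.

Lemma alg_overE u : alg_over u <-> algebraicOver frac_map u.
Proof.
split=> [[P P0 Pu]|[p p0 pu]].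
  exists (map_poly (@FracField.tofrac R) P).
    by rewrite map_poly_eq0_id0 ?tofrac_eq0 ?lead_coef_eq0.
  rewrite -map_poly_comp; rewrite (eq_map_poly (g := phi)) // => x /=.
  exact: frac_map_tofrac.
have [d d0 [P PE]] := clear_denominators p.
exists P.
  apply: contra_neq p0 => P0; move/eqP: PE; rewrite P0 rmorph0 scaler_eq0.
  by rewrite tofrac_eq0 (negPf d0) => /eqP.
have -> : map_poly phi P = map_poly frac_map (map_poly (@FracField.tofrac R) P).
  by rewrite -map_poly_comp; apply: eq_map_poly => x /=; rewrite frac_map_tofrac.
by rewrite -PE map_polyZ rootZ //= frac_map_tofrac phi_neq0.
Qed.

Lemma alg_over_id x : alg_over (phi x).
Proof. by apply/alg_overE; rewrite -frac_map_tofrac; apply: algebraic_id. Qed.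

Lemma alg_overB u v : alg_over u -> alg_over v -> alg_over (u - v).
Proof. by move=> /alg_overE ua /alg_overE va; apply/alg_overE; apply: algebraic_sub. Qed.

Lemma alg_overD u v : alg_over u -> alg_over v -> alg_over (u + v).
Proof. by move=> /alg_overE ua /alg_overE va; apply/alg_overE; apply: algebraic_add. Qed.

Lemma alg_overN u : alg_over u -> alg_over (- u).
Proof. by move=> /alg_overE ua; apply/alg_overE; apply: algebraic_opp. Qed.

Lemma alg_overM u v : alg_over u -> alg_over v -> alg_over (u * v).
Proof. by move=> /alg_overE ua /alg_overE va; apply/alg_overE; apply: algebraic_mul. Qed.

Lemma alg_overV u : alg_over u -> alg_over u^-1.
Proof. by move=> /alg_overE ua; apply/alg_overE; apply: algebraic_inv. Qed.

(** Over a field, algebraic and integral elements coincide, and integrality is transitive. *)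
Lemma alg_over_root (p : {poly F}) u :
  p != 0 -> root p u -> (forall i, alg_over p`_i) -> alg_over u.
Proof.
move=> p0 pu pa; apply/alg_overE/integral_algebraic.
apply: (integral_root p0 pu); apply/integral_poly => i.
by apply/integral_algebraic/alg_overE.
Qed.

Lemma alg_over_horner (p : {poly F}) u :
  alg_over u -> (forall i, alg_over p`_i) -> alg_over p.[u].
Proof.
move=> ua pa; apply/alg_overE/integral_algebraic; apply: integral_horner.
  by apply/integral_poly => i; apply/integral_algebraic/alg_overE.
by apply/integral_algebraic/alg_overE.
Qed.

(** Newton interpolation: if p = q (X - x) + p(x), then q takes the values (p(y) - p(x)) / (y - x)
    at the other nodes, and induction applies to q. *)
Lemma alg_over_interpolation (s : seq F) (p : {poly F}) :
  uniq s -> (size p <= size s)%N ->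
  (forall x, x \in s -> alg_over x /\ alg_over p.[x]) ->
  forall i, alg_over p`_i.
Proof.
have alg0 : alg_over 0 by rewrite -(rmorph0 phi); apply: alg_over_id.
elim: s p => [|x s IH] p /=.
  by rewrite leqn0 size_poly_eq0 => _ /eqP -> _ i; rewrite coef0.
case/andP=> xs us ps sa; have [xa pxa] := sa _ (mem_head x s).
have /factor_theorem[q qE] : root (p - p.[x]%:P) x.
  by rewrite /root hornerD hornerN hornerC subrr.
have pE : p = q * ('X - x%:P) + p.[x]%:P by rewrite -qE subrK.
have sq : (size q <= size s)%N.
  have [->|q0] := eqVneq q 0; first by rewrite size_poly0.
  have sq1 : size (q * ('X - x%:P)) = (size q).+1.
    by rewrite size_mul ?polyXsubC_eq0 // size_XsubC addn2.
  rewrite -ltnS -sq1 -qE (leq_trans (size_polyD _ _)) // geq_max size_polyN ps.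
  by rewrite size_polyC; case: (_ == 0).
have qa : forall i, alg_over q`_i.
  apply: IH => // y ys; have [ya pya] := sa y (mem_behead (s := x :: s) ys).
  split=> //; have yx : y - x != 0 by rewrite subr_eq0; apply: contraNneq xs => <-.
  have -> : q.[y] = (p.[y] - p.[x]) * (y - x)^-1.
    by rewrite {1}pE hornerD hornerM hornerXsubC hornerC addrK mulfK.
  by apply: alg_overM; [apply: alg_overB|apply/alg_overV/alg_overB].
move=> i; rewrite pE coefD coefC mulrBr coefB coefMX coefMC.
apply: alg_overD; last by case: eqP.
apply: alg_overB; first by case: eqP.
exact: alg_overM.
Qed.

End FractionField.

(** Replacing p by a proper nonconstant divisor as long as there is one makes it irreducible, and
    then F[X]/(p) contains a root. *)
Lemma adjoin_root (F : fieldType) (p : {poly F}) : (1 < size p)%N ->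
  exists (L : fieldType) (phi : {rmorphism F -> L}) (x : L), root (map_poly phi p) x.
Proof.
have [b] := ubnP (size p); elim: b p => // b IH p pb p1.
have [[q [qp q1 qlt]]|irr] :=
  pselect (exists q, [/\ q %| p, (1 < size q)%N & (size q < size p)%N]).
  have [|//|L [phi [x qx]]] := IH q; first exact: leq_trans qlt _.
  exists L, phi, x; case/dvdpP: qp => r ->.
  by rewrite rmorphM rootM qx orbT.
have p0 : p != 0 by rewrite -size_poly_gt0 ltnW.
(* The quotient field construction takes a monic irreducible polynomial. *)
pose h := (lead_coef p)^-1 *: p.
have lc0 : (lead_coef p)^-1 != 0 by rewrite invr_eq0 lead_coef_eq0.
have hm : h \is monic by rewrite monicE lead_coefZ mulVf ?lead_coef_eq0.
have hirr : irreducible_poly h.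
  split=> [|q q1 qh]; first by rewrite size_scale.
  have qp : q %| p by move: qh; rewrite dvdpZr.
  apply: (@eqp_trans _ p); last by rewrite eqp_sym eqp_scale.
  rewrite -dvdp_size_eqp //.
  have q0 : q != 0 by apply: contraTneq qp => ->; rewrite dvd0p.
  rewrite eqn_leq dvdp_leq //= leqNgt; apply/negP => lt; apply: irr; exists q.
  by split=> //; rewrite ltn_neqAle eq_sym q1 size_poly_gt0.
pose hI : monic_irreducible_poly h := (hirr, hm).
pose L : fieldType := {poly %/ h with hI}.
pose phi : {rmorphism F -> L} := qpolyC h.
exists L, phi, (qpolyX h : L).
have in_q (q : {poly F}) : (map_poly phi q).[(qpolyX h : L)] = (in_qpoly h q : L).
  elim/poly_ind: q => [|q c IHq]; first by rewrite rmorph0 horner0 in_qpoly0.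
  rewrite rmorphD rmorphM /= map_polyX map_polyC /= hornerMXaddC IHq.
  rewrite in_qpolyD in_qpolyM; congr (_ + _); apply: val_inj.
  rewrite /= Pdiv.CommonRing.rmodp_small // size_polyC.
  by rewrite (leq_ltn_trans _ (size_mk_monic_gt1 _)) //; case: eqP.
have -> : p = lead_coef p *: h by rewrite scalerA mulfV ?lead_coef_eq0 // scale1r.
rewrite /root in_q in_qpolyZ; suff -> : in_qpoly h h = 0 by rewrite scaler0.
by apply: val_inj; rewrite /= (mk_monicE hI) Pdiv.RingMonic.rmodpp.
Qed.

Lemma splitting_extension (F : fieldType) (p : {poly F}) : p \is monic ->
  exists (L : fieldType) (phi : {rmorphism F -> L}) (s : seq L),
    map_poly phi p = \prod_(x <- s) ('X - x%:P).
Proof.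
have [b] := ubnP (size p); elim: b F p => // b IH F p pb pm.
have [p1|p1] := leqP (size p) 1.
  exists F, idfun, [::]; rewrite big_nil map_poly_id //.
  have := size1_polyC p1; move: pm => /[swap] ->.
  by rewrite monicE lead_coefC => /eqP ->.
have [L [phi [x]]] := adjoin_root p1; case/factor_theorem=> q qE.
have pm' : map_poly phi p \is monic by rewrite map_monic.
have qm : q \is monic.
  by rewrite -(monicMr _ (monicXsubC x)) -qE.
have sq : (size q < b)%N.
  rewrite -ltnS (leq_trans _ pb) // -(size_map_poly phi) qE.
  by rewrite size_mul ?monic_neq0 ?monicXsubC // size_XsubC addn2.
have [L' [psi [s sE]]] := IH _ _ sq qm.
exists L', (psi \o phi : {rmorphism F -> L'}), (rcons s (psi x)).
rewrite map_poly_comp qE rmorphM /= sE rmorphB /= map_polyX map_polyC.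
by rewrite big_rcons.
Qed.

(** * Heights of algebraic series *)

Section DegreeBound.

Context (n : nat) (R : comNzRingType).
Implicit Types p q : {mpoly R[n]}.

Definition deg_le (b : nat) p := forall m, (b < mdeg m)%N -> p@_m = 0.

Lemma deg_le0 b : deg_le b 0. Proof. by move=> m _; rewrite mcoeff0. Qed.

Lemma deg_leC c : deg_le 0 c%:MP.
Proof.
by move=> m m0; rewrite mcoeffC -mdeg_eq0 (gtn_eqF m0) mulr0.
Qed.

Lemma deg_leW b c p : (b <= c)%N -> deg_le b p -> deg_le c p.
Proof. by move=> bc pb m cm; apply: pb; apply: leq_ltn_trans cm. Qed.

Lemma deg_leD b p q : deg_le b p -> deg_le b q -> deg_le b (p + q).
Proof. by move=> pb qb m bm; rewrite mcoeffD pb ?qb ?addr0. Qed.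

Lemma deg_leN b p : deg_le b p -> deg_le b (- p).
Proof. by move=> pb m bm; rewrite mcoeffN pb ?oppr0. Qed.

Lemma deg_leM b c p q : deg_le b p -> deg_le c q -> deg_le (b + c) (p * q).
Proof.
move=> pb qc m bm; rewrite mcoeffM big1 // => -[k1 k2] /= /eqP mE.
have [k1b|k1b] := ltnP b (mdeg k1); first by rewrite pb ?mul0r.
rewrite qc ?mulr0 //; have := congr1 (@mdeg n) mE; rewrite mdegD; move: bm k1b; lia.
Qed.

Lemma deg_leX b p j : deg_le b p -> deg_le (b * j) (p ^+ j).
Proof.
move=> pb; elim: j => [|j IH]; first by rewrite muln0; apply: deg_leC.
by rewrite exprS mulnS; apply: deg_leM.
Qed.

Lemma deg_le_sum b (I : Type) (r : seq I) (P : pred I) (F : I -> {mpoly R[n]}) :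
  (forall i, deg_le b (F i)) -> deg_le b (\sum_(i <- r | P i) F i).
Proof.
by move=> Fb; elim/big_ind: _ => //; [apply: deg_le0|move=> *; apply: deg_leD].
Qed.

Lemma deg_le_exists p : exists b, deg_le b p.
Proof.
exists (msize p) => m mb; apply: memN_msupp_eq0; apply: msize_mdeg_ge.
exact: ltnW.
Qed.

Definition coef_deg_le (b : nat) (P : {poly {mpoly R[n]}}) :=
  forall i, deg_le b P`_i.

Lemma coef_deg_leM b c P Q :
  coef_deg_le b P -> coef_deg_le c Q -> coef_deg_le (b + c) (P * Q).
Proof. by move=> Pb Qc i; rewrite coefM; apply: deg_le_sum => j; apply: deg_leM. Qed.

Lemma coef_deg_leD b P Q :
  coef_deg_le b P -> coef_deg_le b Q -> coef_deg_le b (P + Q).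
Proof. by move=> Pb Qc i; rewrite coefD; apply: deg_leD. Qed.

Lemma coef_deg_leC b p : deg_le b p -> coef_deg_le b p%:P.
Proof. by move=> pb i; rewrite coefC; case: eqP => // _; apply: deg_le0. Qed.

Lemma coef_deg_le_exists P : exists b, coef_deg_le b P.
Proof.
elim/poly_ind: P => [|P c [b Pb]]; first by exists 0%N => i; rewrite coef0; apply: deg_le0.
have [d cd] := deg_le_exists c; exists (b + d)%N => i.
rewrite coefD coefMX coefC; apply: deg_leD.
  case: eqP => _; first exact: deg_le0.
  exact: deg_leW (leq_addr _ _) (Pb _).
case: eqP => _; last exact: deg_le0.
exact: deg_leW (leq_addl _ _) cd.
Qed.

(** Leibniz expansion: each term is, up to sign, a product of N entries of the characteristic
    matrix, whose coefficients have degree at most b. *)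
Lemma coef_deg_le_char_poly b N (A : 'M[{mpoly R[n]}]_N) :
  (forall i j, deg_le b (A i j)) -> coef_deg_le (b * N) (char_poly A).
Proof.
move=> Ab; have entry i j : coef_deg_le b (char_poly_mx A i j).
  rewrite !mxE; apply: coef_deg_leD; last first.
    by rewrite -polyCN; apply: coef_deg_leC; apply: deg_leN.
  move=> l; rewrite coefMn coefX; case: (i == j); rewrite ?mulr0n ?mulr1n; last exact: deg_le0.
  by apply: (deg_leW (leq0n b)); case: eqP => _; [exact: deg_leC|exact: deg_le0].
rewrite /char_poly /determinant => l; rewrite coef_sum; apply: deg_le_sum => s.
have prodb (r : seq 'I_N) (F : 'I_N -> {poly {mpoly R[n]}}) :
    (forall i, coef_deg_le b (F i)) ->
    coef_deg_le (b * size r) (\prod_(i <- r) F i).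
  move=> Fb; elim: r => [|i r IH].
    by rewrite big_nil muln0; apply: coef_deg_leC; apply: deg_leC.
  by rewrite big_cons mulnS; apply: coef_deg_leM.
rewrite -[(b * N)%N]add0n; apply: coef_deg_leM.
  have one0 : coef_deg_le 0 1.
    move=> i; rewrite coef1; case: (i == 0%N); last exact: deg_le0.
    by rewrite -mpolyC1; apply: deg_leC.
  case: (odd_perm s); rewrite ?expr0 ?expr1 // => i.
  by rewrite coefN; apply: deg_leN; apply: one0.
have szN : size (index_enum 'I_N) = N.
  by rewrite [index_enum _]unlock -enumT size_enum_ord.
by have := prodb _ _ (fun i => entry i (s i)); move/(_ (index_enum 'I_N)); rewrite szN.
Qed.

End DegreeBound.

Section Height.

Context (k : fieldType) (n : nat).
Implicit Types (f g : {mfps k[n]}) (S : seq {mfps k[n]}) (d : nat).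

Local Notation ser := (@mfps_of_mpoly n k).

(** Polynomial expressions over k of degree at most d in the members of S. They cover polynomials in
    x, products with fixed algebraic series and coefficients of Weierstrass remainders, all of which
    occur in the induction. *)
Inductive gdeg S : nat -> {mfps k[n]} -> Prop :=
| gdegC c : gdeg S 0 (ser c%:MP)
| gdegG f : f \in S -> gdeg S 1 f
| gdegD d f g : gdeg S d f -> gdeg S d g -> gdeg S d (f + g)
| gdegM d e f g : gdeg S d f -> gdeg S e g -> gdeg S (d + e) (f * g)
| gdegW d e f : (d <= e)%N -> gdeg S d f -> gdeg S e f.

(** The e_i span a k(x)-space stable under every f in S; D is a common denominator and c bounds the
    degrees. The e_i may be dependent: the determinant argument uses one nonzero e_i. *)
Definition multiplication_table S :=
  exists (I : finType) (e : I -> {mfps k[n]}) (D : {mpoly k[n]}) (c : nat),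
    [/\ exists i, e i != 0, D != 0, deg_le c D &
      forall f, f \in S -> exists2 A : I -> I -> {mpoly k[n]},
        forall i j, deg_le c (A i j) &
        forall i, ser D * f * e i = \sum_j ser (A i j) * e j].

(** Adjoining f with an equation of degree m replaces the e_i by the products e_i f^j with j < m,
    and multiplies D by the leading coefficient of the equation. *)
Lemma multiplication_table_exists S :
  (forall f, f \in S -> algebraic_series f) -> multiplication_table S.
Proof.
elim: S => [|f S IH] Salg.
  exists unit, (fun=> 1), 1, 0%N; split=> //.
  - by exists tt; apply: oner_neq0.
  - exact: oner_neq0.
  - by rewrite -mpolyC1; apply: deg_leC.
have [|I [e [D [c [[i0 ei0] D0 Dc tab]]]]] := IH.
  by move=> g gS; apply: Salg; rewrite in_cons gS orbT.
have [P P0 Pf] := Salg f (mem_head _ _).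
have [b Pb] := coef_deg_le_exists P.
set m := (size P).-1.
have sP : size P = m.+1 by rewrite /m prednK // size_poly_gt0.
(* A nonzero constant polynomial has no root, so the new family is not empty. *)
have m0 : (0 < m)%N.
  rewrite lt0n; apply/negP => /eqP m0.
  have [a a0 PE] : exists2 a, a != 0 & P = a%:P.
    by apply/size_poly1P; rewrite sP m0.
  by move: Pf; rewrite PE map_polyC /= rootC mfps_of_mpoly_eq0 (negPf a0).
have fm : ser (lead_coef P) * f ^+ m = - \sum_(l < m) ser P`_l * f ^+ l.
  have := Pf; rewrite /root (@horner_coef_wide _ m.+1); last first.
    by rewrite -sP size_poly.
  rewrite big_ord_recr /= addrC addr_eq0 !coef_map /= => /eqP.
  by rewrite lead_coefE -/m => ->; congr (- _); apply: eq_bigr => l _; rewrite coef_map.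
have lb : deg_le b (lead_coef P) by rewrite lead_coefE.
exists (I * 'I_m)%type, (fun p : I * 'I_m => e p.1 * f ^+ p.2), (D * lead_coef P), (c + b)%N.
split.
- by exists (i0, Ordinal m0); rewrite /= expr0 mulr1.
- by rewrite mulf_neq0 // lead_coef_eq0.
- exact: deg_leM.
move=> g; rewrite in_cons => /orP[/eqP ->|gS].
(* Matrix of f: a shift of its powers, except that f^m is rewritten by the equation. *)
- exists (fun p q : I * 'I_m => if p.1 == q.1 then
      if (p.2.+1 < m)%N then if p.2.+1 == q.2 :> nat then D * lead_coef P else 0
      else - (D * P`_(q.2)) else 0) => [[i j] [i' j']|[i j]] /=.
    case: ifP => _; last exact: deg_le0.
    case: ifP => _; last by apply: deg_leN; apply: deg_leM.
    by case: ifP => _; [apply: deg_leM|apply: deg_le0].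
  rewrite -(pair_bigA _ (fun (i' : I) (j' : 'I_m) => ser (if i == i' then
      if (j.+1 < m)%N then if j.+1 == j' :> nat then D * lead_coef P else 0
      else - (D * P`_j') else 0) * (e i' * f ^+ j'))) /=.
  rewrite (bigD1 i) //= eqxx [X in _ + X]big1 ?addr0 => [|i' i'i]; last first.
    by apply: big1 => j' _; rewrite eq_sym (negPf i'i) rmorph0 mul0r.
  case: ltnP => [jm|mj].
    rewrite (bigD1 (Ordinal jm)) //= eqxx [X in _ + X]big1 ?addr0 => [|j' j'j]; last first.
      case: eqP => [jj'|_]; last by rewrite rmorph0 mul0r.
      by case/eqP: j'j; apply: val_inj.
    by rewrite exprS; ring.
  have jE : j.+1 = m :> nat by apply/eqP; rewrite eqn_leq mj ltn_ord.
  transitivity (ser D * e i * (ser (lead_coef P) * f ^+ m)).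
    have -> : f ^+ m = f * f ^+ j by rewrite -exprS jE.
    by rewrite rmorphM; ring.
  rewrite fm mulrN mulr_sumr -sumrN; apply: eq_bigr => l _.
  by rewrite rmorphN rmorphM /=; ring.
(* An old series g acts block-diagonally; the factor [lead_coef P] accounts for the new
   denominator. *)
- have [A Ac AE] := tab g gS.
  exists (fun p q : I * 'I_m => if p.2 == q.2 then lead_coef P * A p.1 q.1
    else 0) => [p q|[i j] /=].
    case: ifP => _; last exact: deg_le0.
    by rewrite addnC; apply: deg_leM.
  rewrite -(pair_bigA _ (fun (i' : I) (j' : 'I_m) =>
     ser (if j == j' then lead_coef P * A i i' else 0) * (e i' * f ^+ j'))) /=.
  transitivity (ser (lead_coef P) * f ^+ j * (ser D * g * e i)).
    by rewrite rmorphM /=; ring.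
  rewrite AE mulr_sumr; apply: eq_bigr => i' _.
  rewrite (bigD1 j) //= eqxx [X in _ + X]big1 ?addr0 => [|j' j'j]; last first.
    by rewrite eq_sym (negPf j'j) rmorph0 mul0r.
  by rewrite rmorphM /=; ring.
Qed.

(* Up to a power of a common denominator, f acts on a finite family of series by a
   matrix over k[x]; P comes from the characteristic polynomial of this matrix. *)
Lemma height_bound S : (forall f, f \in S -> algebraic_series f) ->
  exists C, forall d f, gdeg S d f ->
    exists P : {poly {mpoly k[n]}},
      [/\ P != 0, root (map_poly ser P) f & coef_deg_le (C * d) P].
Proof.
move=> /multiplication_table_exists[I [e [D [c [[i0 ei0] D0 Dc tab]]]]].
(* Sums and products of series are represented by sums and products of matrices, with denominator
   D^d. *)
have reprf d f : gdeg S d f -> exists2 A : I -> I -> {mpoly k[n]},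
    forall i j, deg_le (c * d) (A i j) &
    forall i, ser D ^+ d * f * e i = \sum_j ser (A i j) * e j.
  elim=> {d f} [a|f fS|d f g _ [A Ad AE] _ [B Bd BE]
              |d d' f g _ [A Ad AE] _ [B Bd BE]|d d' f dd' _ [A Ad AE]].
  - exists (fun i j => if i == j then a%:MP else 0) => [i j|i].
      case: ifP => _; last exact: deg_le0.
      exact: deg_leW (leq0n _) (deg_leC a).
    rewrite (bigD1 i) //= eqxx big1 ?addr0 ?expr0 ?mul1r // => j ji.
    by rewrite eq_sym (negPf ji) rmorph0 mul0r.
  - have [A Ac AE] := tab f fS; exists A => [i j|i]; first by rewrite muln1.
    by rewrite expr1.
  - exists (fun i j => A i j + B i j) => [i j|i]; first exact: deg_leD.
    rewrite mulrDr mulrDl AE BE -big_split; apply: eq_bigr => j _.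
    by rewrite rmorphD mulrDl.
  - exists (fun i j => \sum_l B i l * A l j) => [i j|i].
      apply: deg_le_sum => l; rewrite mulnDr addnC; exact: deg_leM.
    transitivity (ser D ^+ d * f * (ser D ^+ d' * g * e i)).
      by rewrite exprD; ring.
    rewrite BE mulr_sumr.
    transitivity (\sum_l \sum_j ser (B i l) * (ser (A l j) * e j)).
      apply: eq_bigr => l _; rewrite -mulr_sumr -AE; ring.
    rewrite exchange_big; apply: eq_bigr => j _.
    by rewrite rmorph_sum mulr_suml; apply: eq_bigr => l _; rewrite rmorphM mulrA.
  - exists (fun i j => D ^+ (d' - d) * A i j) => [i j|i].
      rewrite -(subnKC dd') addKn mulnDr [X in deg_le X]addnC.
      by apply: deg_leM => //; apply: deg_leX.
    transitivity (ser D ^+ (d' - d) * (ser D ^+ d * f * e i)).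
      by rewrite -[in LHS](subnK dd') exprD; ring.
    rewrite AE mulr_sumr; apply: eq_bigr => j _.
    by rewrite rmorphM rmorphXn mulrA.
(* One term c d |I| bounds the characteristic polynomial, the other the powers of D that enter when
   T is replaced by D^d T in it. *)
exists (2 * c * #|I|)%N => d f /reprf[A Ad AE].
pose N := #|I|; pose M : 'M[{mpoly k[n]}]_N := \matrix_(i, j) A (enum_val i) (enum_val j).
pose chi := char_poly M.
have chib : coef_deg_le (c * d * N) chi.
  by apply: coef_deg_le_char_poly => i j; rewrite mxE.
have sz : size chi = N.+1 by rewrite size_char_poly.
pose P := \poly_(i < N.+1) (chi`_i * D ^+ (d * i)).
have rootchi : (map_poly ser chi).[ser D ^+ d * f] = 0.
  pose z := ser D ^+ d * f; pose Mz : 'M[{mfps k[n]}]_N := z%:M - map_mx ser M.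
  have detE : (map_poly ser chi).[z] = \det Mz.
    rewrite /chi /char_poly -det_map_mx -horner_evalE -det_map_mx; congr (\det _).
    apply/matrixP => i j; rewrite !mxE /= horner_evalE rmorphB /= rmorphMn.
    rewrite /= map_polyX map_polyC /=.
    by rewrite hornerD hornerN hornerC hornerMn hornerX.
  (* The matrix z - M kills the vector of the e_i, hence its determinant kills the nonzero entry
     [e i0]. *)
  pose v : 'cV[{mfps k[n]}]_N := \col_i e (enum_val i).
  have Mv : Mz *m v = 0.
    rewrite mulmxBl mul_scalar_mx; apply/eqP; rewrite subr_eq0; apply/eqP.
    apply/matrixP => i j; rewrite !mxE AE (reindex_onto enum_val enum_rank) /=; last first.
      by move=> l _; rewrite enum_rankK.
    apply: eq_big => [l|l _]; first by rewrite enum_valK eqxx.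
    by rewrite !mxE.
  have : \det Mz *: v = 0 by rewrite -mul_scalar_mx -mul_adj_mx -mulmxA Mv mulmx0.
  move/matrixP/(_ (enum_rank i0) ord0); rewrite !mxE enum_rankK => /eqP.
  by rewrite mulf_eq0 (negPf ei0) orbF detE => /eqP.
exists P; split.
- apply/eqP => /(congr1 (fun Q : {poly _} => Q`_N)); rewrite coef_poly ltnSn coef0 => /eqP.
  rewrite mulf_eq0 expf_eq0 (negPf D0) andbF orbF.
  have -> : chi`_N = lead_coef chi by rewrite lead_coefE sz.
  by rewrite (monicP (char_poly_monic M)) oner_eq0.
- rewrite /root -rootchi (@horner_coef_wide _ N.+1); last first.
    by rewrite (leq_trans (size_poly _ _)) // size_poly.
  rewrite (@horner_coef_wide _ N.+1); last by rewrite (leq_trans (size_poly _ _)) // sz.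
  apply/eqP; apply: eq_bigr => i _.
  by rewrite !coef_map coef_poly ltn_ord /= rmorphM rmorphXn exprMn exprM mulrA.
- move=> i; rewrite coef_poly; case: ltnP => iN; last exact: deg_le0.
  apply: (@deg_leW _ _ (c * d * N + c * (d * i))).
    have di : (c * (d * i) <= c * (d * N))%N by rewrite !leq_mul2l -ltnS iN !orbT.
    apply: (leq_trans (leq_add (leqnn _) di)); rewrite -/N.
    by lia.
  by apply: deg_leM => //; apply: deg_leX.
Qed.

Lemma gdeg_algebraic S d f : (forall f, f \in S -> algebraic_series f) ->
  gdeg S d f -> algebraic_series f.
Proof.
by move=> /height_bound[C CP] /CP[P [P0 Pf _]]; exists P.
Qed.

(** After cancelling the lowest power f^j in the equation, all terms other than P_j are multiples of
    f. *)
Lemma root_const_neq0 (P : {poly {mpoly k[n]}}) f :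
  P != 0 -> root (map_poly ser P) f -> f != 0 ->
  exists2 j, P`_j != 0 & exists g, ser P`_j = g * f.
Proof.
move=> P0 Pf f0.
have ex : exists j, P`_j != 0 by exists (size P).-1; rewrite -lead_coefE lead_coef_eq0.
exists (ex_minn ex); case: ex_minnP => j Pj jmin //.
pose s := size P; have js : (j < s)%N.
  by rewrite ltnNge; apply: contra Pj => sj; rewrite nth_default.
exists (- \sum_(i < s - j.+1) ser P`_(j.+1 + i)%N * f ^+ i).
apply: (mulfI (expf_neq0 j f0)).
move: Pf; rewrite /root (@horner_coef_wide _ s) ?size_poly //.
rewrite -(big_mkord xpredT (fun i => (map_poly ser P)`_i * f ^+ i)).
rewrite (big_cat_nat (n := j.+1)) // /= big_nat_recr //= big1_seq ?add0r; last first.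
  move=> i; rewrite mem_index_iota => /andP[_ /andP[_ ij]].
  rewrite coef_map /=; suff -> : P`_i = 0 by rewrite rmorph0 mul0r.
  by apply/eqP; apply: contraTT ij => Pi; rewrite -leqNgt jmin.
rewrite coef_map /= addr_eq0 => /eqP; rewrite mulrC => ->.
rewrite -{1}[j.+1]add0n big_addn big_mkord mulNr mulrN mulr_suml mulr_sumr.
congr (- _); apply: eq_bigr => i _; rewrite coef_map /= [(i + _)%N]addnC.
by rewrite addSn exprS exprD; ring.
Qed.

Lemma algebraic_divides_mpoly f : algebraic_series f -> f != 0 ->
  exists2 h, h != 0 & exists g, ser h = g * f.
Proof.
move=> [P P0 Pf] f0; have [j Pj gf] := root_const_neq0 P0 Pf f0.
by exists P`_j.
Qed.

(** The series f divides a nonzero coefficient of its equation, and the order of a nonzero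
    polynomial is at most its degree. *)
Lemma gdeg_order_bound S : (forall f, f \in S -> algebraic_series f) ->
  exists C, forall d f c, gdeg S d f -> f != 0 -> low c f -> (c <= C * d)%N.
Proof.
move=> /height_bound[C CP]; exists C => d f c /CP[P [P0 Pf Pd]] f0 fc.
have [j Pj [g gE]] := root_const_neq0 P0 Pf f0.
have cP : low c (ser P`_j) by rewrite gE; apply: wlowMl => //; apply: mdegD.
rewrite leqNgt; apply/negP => lt; case/eqP: Pj; apply/mpolyP => m.
rewrite mcoeff0; have [mc|mc] := ltnP (mdeg m) c; first exact: cP.
by apply: Pd; apply: leq_trans mc.
Qed.

End Height.

(** * Specialization of algebraic series *)

Section LastVariablePolynomials.

Context (n : nat) (k : fieldType).

Local Notation ser := (@mfps_of_mpoly _ k).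

Lemma muniXE (m : 'X_{1..n.+1}) :
  muni ('X_[m] : {mpoly k[n.+1]}) = 'X_[mrest m] *: 'X^(m ord_max).
Proof.
rewrite muniE msuppX big_seq1 mcoeffX eqxx scale1r.
by congr ('X_[_] *: _); apply/mnmP => i; rewrite !mnmE lift_max_widen.
Qed.

Lemma muni_lastX : muni ('X_ord_max : {mpoly k[n.+1]}) = 'X.
Proof.
rewrite muniXE mnm1E eqxx expr1; have -> : mrest U_(@ord_max n) = 0%MM.
  by have := mrest_max n 1; rewrite mulm1n.
by rewrite mpolyX0 scale1r.
Qed.

Lemma muni_liftX (i : 'I_n) : muni ('X_(lift ord_max i) : {mpoly k[n.+1]}) = ('X_i)%:P.
Proof.
rewrite muniXE mnm1E eq_sym (negPf (neq_lift _ _)) expr0 -mul_polyC mulr1.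
by congr ('X_[_])%:P; apply/mnmP => l; rewrite mnmE !mnm1E (inj_eq lift_inj).
Qed.

Lemma pser_muni (p : {mpoly k[n.+1]}) : ser p = pser (map_poly ser (muni p)).
Proof.
apply: (@mpoly_hom_ext n.+1 k {mfps k[n.+1]} ser
  (@pser n k \o (map_poly ser \o @muni n k))) => [c|i].
  by rewrite /= muniC map_polyC /= pserC msubstC.
rewrite /=; case: (unliftP ord_max i) => [j|] ->.
  by rewrite muni_liftX map_polyC /= pserC msubstX.
by rewrite muni_lastX map_polyX pserX.
Qed.

Lemma muni_eq0 (p : {mpoly k[n.+1]}) : (muni p == 0) = (p == 0).
Proof.
apply/eqP/eqP => [p0|->]; last exact: muni0.
by apply: mfps_of_mpoly_inj; rewrite pser_muni p0 !rmorph0.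
Qed.

Lemma zdel_pser (p : {poly {mfps k[n]}}) :
  msubst (zdel k ord_max) (pser p) = p`_0.
Proof.
elim/poly_ind: p => [|p c _]; first by rewrite !rmorph0 coef0.
rewrite pser_MXaddC rmorphD rmorphM /= zdel_X mulr0 add0r zinsK.
by rewrite coefD coefMX coefC eqxx add0r.
Qed.

(* After division by a power of X, the equation of f stays nonzero at X = 0. *)
Lemma algebraic_specialize (f : {mfps k[n.+1]}) :
  algebraic_series f -> algebraic_series (msubst (zdel k ord_max) f).
Proof.
move=> [P P0 Pf].
(* The least exponent of X occurring in the coefficients of the equation. *)
have ex : exists j, `[< exists i, (muni P`_i)`_j != 0 >].
  exists (size (muni (lead_coef P))).-1; apply/asboolP; exists (size P).-1.
  by rewrite -lead_coefE -lead_coefE lead_coef_eq0 muni_eq0 lead_coef_eq0.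
case: (ex_minnP ex) => j /asboolP[i0 Pi0] jmin.
pose Q := \poly_(i < size P) (muni P`_i)`_j.
exists Q.
  apply: contraNneq Pi0 => /(congr1 (fun Q : {poly _} => Q`_i0)).
  rewrite coef_poly coef0; case: ltnP => [_ ->//|i0P].
  have -> : P`_i0 = 0 by apply: nth_default.
  by rewrite raddf0 coef0.
pose q i := drop_poly j (muni P`_i).
have PE i : ser P`_i = lastX ^+ j * pser (map_poly ser (q i)).
  rewrite pser_muni -{1}(poly_take_drop j (muni P`_i)).
  have -> : take_poly j (muni P`_i) = 0.
    apply/polyP => l; rewrite coef_take_poly coef0; case: ltnP => // lj.
    apply/eqP; apply: contraTT lj => ql; rewrite -leqNgt; apply: jmin.
    by apply/asboolP; exists i.
  by rewrite add0r rmorphM /= map_polyXn rmorphM rmorphXn /= pserX mulrC.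
have sum0 : \sum_(i < size P) pser (map_poly ser (q i)) * f ^+ i = 0.
  have X0 : (lastX : {mfps k[n.+1]}) ^+ j != 0.
    by rewrite expf_neq0 // mfps_of_mpoly_eq0 -msize_poly_eq0 msizeX.
  apply: (mulfI X0); rewrite mulr0 mulr_sumr.
  move: Pf; rewrite /root (@horner_coef_wide _ (size P)) ?size_poly // => /eqP Pf0.
  rewrite -[RHS]Pf0.
  by apply: eq_bigr => i _; rewrite coef_map /= PE mulrA.
rewrite /root (@horner_coef_wide _ (size P)); last first.
  by rewrite (leq_trans (size_poly _ _)) // size_poly.
have := congr1 (msubst (zdel k ord_max)) sum0; rewrite rmorph0 rmorph_sum /= => s0.
apply/eqP; rewrite -[RHS]s0; apply: eq_bigr => i _.
rewrite rmorphM rmorphXn /= zdel_pser !coef_map /= coef_poly ltn_ord.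
by rewrite coef_drop_poly add0n.
Qed.

End LastVariablePolynomials.

(** * Inserting and removing the deformation parameter t *)

Section Deformation.

Context (n : nat) (R : comNzRingType).

(* With n.+2 variables, the new variable t comes just before the last one. *)
Definition tvar : 'I_n.+2 := lift ord_max (ord_max : 'I_n.+1).

Lemma lift_tvar_max : lift tvar (ord_max : 'I_n.+1) = ord_max.
Proof. by apply: val_inj; rewrite /= /bump ltnn add0n leqnn. Qed.

Lemma lift_tvar_lift (i : 'I_n) : lift tvar (lift ord_max i) = lift ord_max (lift ord_max i).
Proof.
apply: val_inj; rewrite /= /bump.
have := ltn_ord i; case: i => i /= ilt _; lia.
Qed.

Lemma tins_wid (c : {mfps R[n]}) :
  msubst (zins R tvar) (mwid c) = mwid (mwid c).
Proof.
have y0 i : ('X_(lift tvar (lift ord_max i)) : {mpoly R[n.+2]})@_0%MM = 0.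
  by rewrite mcoeffX mnm1_eq0.
rewrite (@msubst_comp_ext _ _ _ _ _ _ (ZSubst y0)) => [|i]; last first.
  by rewrite /= mmapX mmap1U.
rewrite (@msubst_comp_ext _ _ _ _ _ _ (ZSubst y0)) // => i.
by rewrite /= mmapX mmap1U /= lift_tvar_lift.
Qed.

Lemma tdel_wid (c : {mfps R[n.+1]}) :
  msubst (zdel R tvar) (mwid c) = mwid (msubst (zdel R ord_max) c).
Proof.
pose y (i : 'I_n.+1) : {mpoly R[n.+1]} :=
  if unlift ord_max i is Some j then 'X_(lift ord_max j) else 0.
have y0 i : (y i)@_0%MM = 0.
  by rewrite /y; case: unlift => [j|]; rewrite ?mcoeff0 // mcoeffX mnm1_eq0.
rewrite (@msubst_comp_ext _ _ _ _ _ _ (ZSubst y0)) => [|i]; last first.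
  rewrite /= /y mmapX mmap1U /=; case: (unliftP ord_max i) => [j|] ->.
    by rewrite -lift_tvar_lift liftK.
  by rewrite unlift_none.
rewrite (@msubst_comp_ext _ _ _ _ _ _ (ZSubst y0)) // => i.
rewrite /= /y; case: unlift => [j|]; last exact: raddf0.
by rewrite mmapX mmap1U.
Qed.

(** With X as polynomial variable, inserting t or setting t = 0 acts on coefficients only, so both
    are compatible with division with respect to X. *)
Lemma tins_pser (p : {poly {mfps R[n]}}) :
  msubst (zins R tvar) (pser p) = pser (map_poly mwid p).
Proof.
elim/poly_ind: p => [|p c IH]; first by rewrite !rmorph0.
rewrite pser_MXaddC rmorphD rmorphM /= IH.
rewrite msubstX /= lift_tvar_max tins_wid.
by rewrite rmorphD rmorphM /= map_polyX map_polyC /= pser_MXaddC.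
Qed.

Lemma tdel_pser (p : {poly {mfps R[n.+1]}}) :
  msubst (zdel R tvar) (pser p) = pser (map_poly (msubst (zdel R ord_max)) p).
Proof.
elim/poly_ind: p => [|p c IH]; first by rewrite !rmorph0.
rewrite pser_MXaddC rmorphD rmorphM /= IH.
have -> : msubst (zdel R tvar) lastX = lastX.
  by rewrite msubstX /= -[X in unlift _ X]lift_tvar_max liftK.
rewrite tdel_wid.
by rewrite rmorphD rmorphM /= map_polyX map_polyC /= pser_MXaddC.
Qed.

End Deformation.

(** A repeated member of s would be a root of the derivative of p. *)
Lemma uniq_simple_roots (F : fieldType) (p q : {poly F}) (s : seq F) :
  p = q * \prod_(x <- s) ('X - x%:P) ->
  (forall x, x \in s -> (p^`()).[x] != 0) -> uniq s.
Proof.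
elim: s q => //= x s IH q pE px; apply/andP; split; last first.
  apply: (IH (q * ('X - x%:P))); first by rewrite pE big_cons mulrA.
  by move=> y ys; apply: px; rewrite in_cons ys orbT.
apply/negP => xs; have /factor_theorem[r rE] : root (\prod_(y <- s) ('X - y%:P)) x.
  by rewrite root_prod_XsubC.
have := px x (mem_head _ _); rewrite pE big_cons rE.
rewrite !derivM derivXsubC !(hornerM, hornerD, hornerN, hornerX, hornerC) subrr.
by rewrite !(mulr0, mul0r, addr0) eqxx.
Qed.

(** * Weierstrass remainders of algebraic series *)

Section Remainders.

Context (n : nat) (k : fieldType) (a : nat) (h : {mpoly k[n.+1]}).

Local Notation ser := (@mfps_of_mpoly _ k).

Hypothesis h_reg : xregular a (ser h).
Hypothesis h_sep : (muni h)^`() != 0.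

(* The series h + t. *)
Let Ht : {poly {mfps k[n.+1]}} :=
  map_poly (mwid \o ser) (muni h) + (lastX : {mfps k[n.+1]})%:P.
Let ht : {mfps k[n.+2]} := pser Ht.

Let mfcoef_wid0 (c : {mfps k[n]}) : mfcoef (mwid c) 0%MM = mfcoef c 0%MM.
Proof.
rewrite widE /= mnm0E eqxx; congr (mfcoef c _).
by apply/mnmP => i; rewrite !mnmE.
Qed.

(** The parameter t vanishes on the X-axis, so h and h + t have the same restriction to it. *)
Let ht_reg : xregular a ht.
Proof.
have E j : mfcoef ht (mext 0%MM j) = mfcoef (ser h) (mext 0%MM j).
  rewrite pser_muni !mfcoef_pser !mext_max !mrest_ext coefD coefC mfcoefD.
  have -> : (map_poly (mwid \o ser) (muni h))`_j = mwid (ser (muni h)`_j).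
    by rewrite coef_map.
  have -> : (map_poly ser (muni h))`_j = ser (muni h)`_j by rewrite coef_map.
  rewrite mfcoef_wid0.
  rewrite -[RHS]addr0; congr (_ + _); case: eqP => // _.
  by rewrite /= mcoeffX mnm1_eq0.
by split=> [j ja|]; rewrite E; [apply: h_reg.1|apply: h_reg.2].
Qed.

Let tins_h : msubst (zins k (tvar n)) (ser h) = ht - mwid lastX.
Proof.
rewrite pser_muni tins_pser /ht /Ht rmorphD /= pserC addrK -map_poly_comp.
by [].
Qed.

Let tdel_ht : msubst (zdel k (tvar n)) ht = ser h.
Proof.
have -> : ht = msubst (zins k (tvar n)) (ser h) + mwid lastX by rewrite tins_h subrK.
by rewrite rmorphD /= zinsK tdel_wid zdel_X rmorph0 addr0.
Qed.

(** At t = 0 a division of f by h + t becomes a division of f by h, and remainders are unique. *)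
Lemma wrem_deform f j :
  (wrem h_reg f)`_j =
  msubst (zdel k ord_max) (wrem ht_reg (msubst (zins k (tvar n)) f))`_j.
Proof.
have [Q fE] := wremP ht_reg (msubst (zins k (tvar n)) f).
suff -> : wrem h_reg f = map_poly (msubst (zdel k ord_max))
    (wrem ht_reg (msubst (zins k (tvar n)) f)) by rewrite coef_map.
apply: (@wrem_eq _ _ _ _ _ _ (msubst (zdel k (tvar n)) Q)).
  by rewrite (leq_trans (size_poly _ _)) // size_wrem.
rewrite -tdel_pser -tdel_ht -rmorphM -rmorphD -fE /=.
by rewrite zinsK.
Qed.

(** The Weierstrass polynomial of h + t: monic of degree a and a multiple of h + t. *)
Let G : {poly {mfps k[n.+1]}} := 'X^a - wrem ht_reg (lastX ^+ a).

Let size_G : size G = a.+1.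
Proof.
by rewrite size_polyDl size_polyXn // size_polyN ltnS size_wrem.
Qed.

Let G_monic : G \is monic.
Proof.
rewrite monicE lead_coefE size_G /= coefB coefXn eqxx.
by rewrite nth_default ?subr0 ?size_wrem.
Qed.

Let wrem_pser_mod (p : {poly {mfps k[n.+1]}}) :
  wrem ht_reg (pser p) = Pdiv.CommonRing.rmodp p G.
Proof.
have [Q XaE] := wremP ht_reg (lastX ^+ a).
have GE : pser G = ht * Q.
  by rewrite rmorphB rmorphXn /= pserX {1}XaE addrK.
apply: (@wrem_eq _ _ _ _ _ _ (Q * pser (Pdiv.CommonRing.rdivp p G))).
  by rewrite -ltnS -size_G Pdiv.CommonRing.ltn_rmodp monic_neq0.
rewrite mulrA -GE -rmorphM -rmorphD /= mulrC.
by rewrite -(Pdiv.RingMonic.rdivp_eq G_monic).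
Qed.

(** A root of G defines a morphism on all of k[[x', t, X]]: modulo h + t every series is a
    polynomial in X, and on polynomials the remainder is the Euclidean one by G. No convergence at
    al is involved. *)
Let evaluation (F : fieldType) (phi : {rmorphism {mfps k[n.+1]} -> F}) (al : F) :
  (map_poly phi G).[al] = 0 ->
  exists ev : {rmorphism {mfps k[n.+2]} -> F},
    (forall f, ev f = (map_poly phi (wrem ht_reg f)).[al]) /\
    (forall p, ev (pser p) = (map_poly phi p).[al]).
Proof.
move=> G_al; pose ev f := (map_poly phi (wrem ht_reg f)).[al].
have ev_pser p : ev (pser p) = (map_poly phi p).[al].
  rewrite /ev wrem_pser_mod {2}(Pdiv.RingMonic.rdivp_eq G_monic p).
  by rewrite rmorphD rmorphM /= hornerD hornerM G_al mulr0 add0r.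
have evB : zmod_morphism ev.
  by move=> f g; rewrite /ev raddfB rmorphB hornerD hornerN.
have evM : monoid_morphism ev.
  split=> [|f g].
    by rewrite -(rmorph1 (@pser n.+1 k)) ev_pser rmorph1 hornerC.
  rewrite {1}/ev wrem_mulr mulrC wrem_mulr -rmorphM -/(ev _) ev_pser.
  by rewrite rmorphM hornerM mulrC.
pose evr : {rmorphism {mfps k[n.+2]} -> F} :=
  HB.pack ev (GRing.isZmodMorphism.Build _ _ ev evB)
             (GRing.isMonoidMorphism.Build _ _ ev evM).
by exists evr.
Qed.

Lemma algebraic_wrem f : algebraic_series f ->
  forall j, algebraic_series (wrem h_reg f)`_j.
Proof.
move=> [P P0 Pf] j; rewrite wrem_deform; apply: algebraic_specialize.
move: j; set ft := msubst _ f; set r := wrem ht_reg ft.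
pose frac := @FracField.tofrac {mfps k[n.+1]}.
have frac_inj : injective frac by move=> x y /eqP; rewrite tofrac_eq => /eqP.
have [F [psi [s sE]]] := splitting_extension (monic_map frac G_monic).
pose phi : {rmorphism {mfps k[n.+1]} -> F} := psi \o frac.
have phi_inj : injective phi by move=> x y /fmorph_inj /frac_inj.
have GsE : map_poly phi G = \prod_(x <- s) ('X - x%:P).
  by rewrite -sE -map_poly_comp.
have ss : size s = a.
  apply/eqP; rewrite -eqSS -size_G -(size_map_inj_poly phi_inj (rmorph0 _)) GsE.
  by rewrite size_prod_XsubC.
have G_al al : al \in s -> (map_poly phi G).[al] = 0.
  by move=> als; apply/rootP; rewrite GsE root_prod_XsubC.
(* The embeddings of k[x'] and of k[x', t] into the splitting field. *)
pose psi0 : {rmorphism {mpoly k[n]} -> F} := phi \o (mwid \o ser).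
pose chi : {rmorphism {mpoly k[n.+1]} -> F} := phi \o ser.
have chi_inj : injective chi by move=> x y /phi_inj /mfps_of_mpoly_inj.
have wid_inj : injective (mwid : {mfps k[n]} -> {mfps k[n.+1]}).
  exact: can_inj (@zinsK _ _ _).
have psi0_inj : injective psi0 by move=> x y /phi_inj /wid_inj /mfps_of_mpoly_inj.
have psi0E c : alg_over chi (psi0 c).
  by rewrite /psi0 /= msubst_mpoly; apply: (alg_over_id chi_inj).
pose H := map_poly phi Ht.
have HE : H = map_poly psi0 (muni h) + (phi lastX)%:P.
  rewrite /H /Ht rmorphD /= map_polyC -map_poly_comp /=; congr (_ + _).
have H_al al : al \in s -> H.[al] = 0.
  move=> als; have [ev [evE evp]] := evaluation (G_al al als).
  by rewrite /H -evp evE -[pser Ht]mulr1 wrem_mulh rmorph0 horner0.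
have H' : H^`() = map_poly psi0 (muni h)^`().
  by rewrite HE derivD derivC addr0 deriv_map.
have H'0 : H^`() != 0.
  rewrite H' map_poly_eq0_id0 // -(rmorph0 psi0) (inj_eq psi0_inj).
  by rewrite lead_coef_eq0.
have transcendental al : H.[al] = 0 -> alg_over psi0 al -> False.
  move=> Hal ala; have [Q Q0 Qr] : alg_over psi0 (phi lastX).
    have -> : phi lastX = - (map_poly psi0 (muni h)).[al].
      by move/eqP: Hal; rewrite HE hornerD hornerC addrC addr_eq0 => /eqP.
    apply/(alg_overN psi0_inj)/(alg_over_horner psi0_inj) => // i.
    by rewrite coef_map; apply: (alg_over_id psi0_inj).
  move: Qr; rewrite /root.
  (* An equation of t over k[x'] is a polynomial in an independent variable; [pser_inj] excludes
     it. *)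
  have -> : (map_poly psi0 Q).[phi lastX] = phi (pser (map_poly ser Q)).
    by rewrite /pser -horner_map /= -!map_poly_comp.
  rewrite -(rmorph0 phi) (inj_eq phi_inj) -(rmorph0 (@pser n k)) (inj_eq (@pser_inj n k)).
  rewrite map_poly_eq0_id0 ?mfps_of_mpoly_eq0 ?lead_coef_eq0 //.
  by apply/negP.
have alg_root al (q : {poly {mpoly k[n]}}) : q != 0 -> al \in s -> (map_poly psi0 q).[al] != 0.
  move=> q0 als; apply/eqP => qal; apply: (transcendental al (H_al al als)).
  by exists q => //; apply/rootP.
have s_uniq : uniq s.
  (* G divides Ht, because the remainder of h + t by itself is zero; so multiple roots of G would be
     roots of the derivative of Ht. *)
  have HG : H = map_poly phi (Pdiv.CommonRing.rdivp Ht G) * \prod_(x <- s) ('X - x%:P).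
    rewrite -GsE -rmorphM /= {1}/H {1}(Pdiv.RingMonic.rdivp_eq G_monic Ht).
    by rewrite -wrem_pser_mod -[pser Ht]mulr1 wrem_mulh addr0.
  apply: (uniq_simple_roots HG) => x xs; rewrite H'; exact: alg_root.
have s_alg al : al \in s -> alg_over chi al.
  move=> als; apply: (@alg_over_root _ _ _ chi_inj H).
  - by apply: contraNneq H'0 => ->; rewrite deriv0.
  - by apply/rootP/H_al.
  - move=> i; rewrite HE coefD coef_map coefC; apply: (alg_overD chi_inj); first exact: psi0E.
    case: (i == 0%N); first exact: (alg_over_id chi_inj 'X_ord_max).
    by rewrite -(rmorph0 chi); apply: (alg_over_id chi_inj).
(* Evaluation at X = al keeps the equation P of f nonzero, by transcendence of al, and its
   coefficients become polynomials in al over k[x']. *)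
have r_alg al : al \in s -> alg_over chi (map_poly phi r).[al].
  move=> als; have [ev0 [ev0E ev0p]] := evaluation (G_al al als).
  pose ev : {rmorphism {mfps k[n.+1]} -> F} := ev0 \o msubst (zins k (tvar n)).
  pose evp : {rmorphism {mpoly k[n.+1]} -> F} := ev \o ser.
  have evpE p : evp p = (map_poly psi0 (muni p)).[al].
    by rewrite /evp /ev /= pser_muni tins_pser ev0p -!map_poly_comp.
  apply: (@alg_over_root _ _ _ chi_inj (map_poly evp P)).
  - rewrite map_poly_eq0_id0 //; change (evp (lead_coef P) != 0); rewrite evpE.
    by apply: alg_root => //; rewrite muni_eq0 lead_coef_eq0.
  - have -> : map_poly evp P = map_poly ev (map_poly ser P) by rewrite -map_poly_comp.
    have -> : (map_poly phi r).[al] = ev f by rewrite /ev /= ev0E.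
    by rewrite rmorph_root.
  - move=> i; rewrite coef_map; change (alg_over chi (evp P`_i)); rewrite evpE.
    apply: (alg_over_horner chi_inj); first exact: s_alg.
    by move=> l; rewrite coef_map; apply: psi0E.
move=> j.
(* The remainder has size at most a and is determined by its values at the a distinct roots. *)
have [Q Q0 Qr] : alg_over chi (map_poly phi r)`_j.
  apply: (alg_over_interpolation chi_inj s_uniq) => [|x xs].
    by rewrite ss (leq_trans (size_poly _ _)) // size_wrem.
  by split; [apply: s_alg|apply: r_alg].
exists Q => //; move: Qr; rewrite coef_map /root.
have -> : map_poly chi Q = map_poly phi (map_poly ser Q) by rewrite -map_poly_comp.
by rewrite horner_map -(rmorph0 phi) (inj_eq phi_inj).
Qed.

End Remainders.

(** * Algebraically spanned submodules *)

Section AlgebraicClosure.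

Context (k : fieldType) (n : nat).
Implicit Types f g : {mfps k[n]}.

(** Sums and products are polynomial expressions in f and g, to which the height bound applies. *)
Lemma algebraic_seriesD f g : algebraic_series f -> algebraic_series g ->
  algebraic_series (f + g).
Proof.
move=> fa ga; apply: (@gdeg_algebraic _ _ [:: f; g] 1) => [x|].
  by rewrite !inE => /orP[] /eqP ->.
by apply: gdegD; apply: gdegG; rewrite !inE eqxx ?orbT.
Qed.

Lemma algebraic_seriesM f g : algebraic_series f -> algebraic_series g ->
  algebraic_series (f * g).
Proof.
move=> fa ga; apply: (@gdeg_algebraic _ _ [:: f; g] (1 + 1)) => [x|].
  by rewrite !inE => /orP[] /eqP ->.
by apply: gdegM; apply: gdegG; rewrite !inE eqxx ?orbT.
Qed.

Lemma algebraic_mpoly (p : {mpoly k[n]}) : algebraic_series (mfps_of_mpoly p).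
Proof.
exists ('X - p%:P); first by rewrite polyXsubC_eq0.
by rewrite rmorphB /= map_polyX map_polyC root_XsubC.
Qed.

Lemma algebraic_series0 : algebraic_series (0 : {mfps k[n]}).
Proof. by rewrite -(rmorph0 (@mfps_of_mpoly n k)); apply: algebraic_mpoly. Qed.

Lemma algebraic_series1 : algebraic_series (1 : {mfps k[n]}).
Proof. by rewrite -(rmorph1 (@mfps_of_mpoly n k)); apply: algebraic_mpoly. Qed.

Lemma algebraic_seriesN f : algebraic_series f -> algebraic_series (- f).
Proof.
move=> fa; rewrite -mulN1r -(rmorphN1 (@mfps_of_mpoly n k)).
by apply: algebraic_seriesM => //; apply: algebraic_mpoly.
Qed.

Lemma algebraic_series_sum (I : Type) (r : seq I) (P : pred I) (F : I -> {mfps k[n]}) :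
  (forall i, algebraic_series (F i)) -> algebraic_series (\sum_(i <- r | P i) F i).
Proof.
by move=> Fa; elim/big_ind: _ => //; [apply: algebraic_series0|apply: algebraic_seriesD].
Qed.

Lemma algebraic_series_prod (I : Type) (r : seq I) (P : pred I) (F : I -> {mfps k[n]}) :
  (forall i, algebraic_series (F i)) -> algebraic_series (\prod_(i <- r | P i) F i).
Proof.
by move=> Fa; elim/big_ind: _ => //; [apply: algebraic_series1|apply: algebraic_seriesM].
Qed.

Lemma algebraic_series_det m (A : 'M[{mfps k[n]}]_m) :
  (forall i j, algebraic_series (A i j)) -> algebraic_series (\det A).
Proof.
move=> Aa; apply: algebraic_series_sum => s; apply: algebraic_seriesM; last first.
  exact: algebraic_series_prod.
by case: (odd_perm s); [apply: algebraic_seriesN|]; apply: algebraic_series1.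
Qed.

Lemma algebraic_series_adj m (A : 'M[{mfps k[n]}]_m) :
  (forall i j, algebraic_series (A i j)) ->
  forall i j, algebraic_series (\adj A i j).
Proof.
move=> Aa i j; rewrite mxE /cofactor; apply: algebraic_seriesM.
  rewrite -signr_odd; case: odd; [apply: algebraic_seriesN|]; apply: algebraic_series1.
by apply: algebraic_series_det => i' j'; rewrite !mxE.
Qed.

Lemma algebraic_series_mulmx m p q (A : 'M[{mfps k[n]}]_(m, p)) (B : 'M_(p, q)) :
  (forall i j, algebraic_series (A i j)) -> (forall i j, algebraic_series (B i j)) ->
  forall i j, algebraic_series ((A *m B) i j).
Proof.
move=> Aa Ba i j; rewrite mxE; apply: algebraic_series_sum => l.
exact: algebraic_seriesM.
Qed.

End AlgebraicClosure.

Section LinearSpan.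

Context (R : nzRingType) (V : lmodType R) (S : V -> Prop).

Lemma lin_span_scale (a : R) v : S v -> lin_span S (a *: v).
Proof.
by move=> Sv; exists 1%N, (fun=> a), (fun=> v); split=> //; rewrite big_ord1.
Qed.

Lemma lin_span0 : lin_span S 0.
Proof. by exists 0%N, (fun=> 0), (fun=> 0); split=> [[]//|]; rewrite big_ord0. Qed.

Lemma lin_spanD u v : lin_span S u -> lin_span S v -> lin_span S (u + v).
Proof.
move=> [r [a [w [Sw ->]]]] [r' [a' [w' [Sw' ->]]]].
exists (r + r')%N, (fun i => match split i with inl j => a j | inr j => a' j end),
  (fun i => match split i with inl j => w j | inr j => w' j end).
split=> [i|]; first by case: split.
rewrite big_split_ord /=; congr (_ + _); apply: eq_bigr => i _.
  by rewrite (unsplitK (inl i)).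
by rewrite (unsplitK (inr i)).
Qed.

Lemma lin_span_sum (I : Type) (r : seq I) (P : pred I) (F : I -> V) :
  (forall i, lin_span S (F i)) -> lin_span S (\sum_(i <- r | P i) F i).
Proof.
by move=> FS; elim/big_ind: _ => //; [apply: lin_span0|apply: lin_spanD].
Qed.

End LinearSpan.

Section Submodules.

Context (k : fieldType) (n s : nat).
Implicit Types N : 'rV[{mfps k[n]}]_s -> Prop.

Definition submodule N := N 0 /\ forall a u v, N u -> N v -> N (a *: u + v).

Definition algebraic_row (v : 'rV[{mfps k[n]}]_s) :=
  forall j, algebraic_series (v 0 j).

(** No generators are fixed: in this form the property passes directly to images under Weierstrass
    remainders and coordinate changes. *)
Definition algebraically_spanned N :=
  forall v, N v -> lin_span (fun w => N w /\ algebraic_row w) v.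

Variable N : 'rV[{mfps k[n]}]_s -> Prop.
Hypothesis N_sub : submodule N.

Lemma submoduleZ a v : N v -> N (a *: v).
Proof. by move=> Nv; have := N_sub.2 a _ _ Nv N_sub.1; rewrite addr0. Qed.

Lemma submoduleD u v : N u -> N v -> N (u + v).
Proof. by move=> Nu Nv; have := N_sub.2 1 _ _ Nu Nv; rewrite scale1r. Qed.

Lemma submoduleN v : N v -> N (- v).
Proof. by move=> Nv; rewrite -scaleN1r; apply: submoduleZ. Qed.

Lemma submodule_sum (I : Type) (r : seq I) (F : I -> 'rV[{mfps k[n]}]_s) :
  (forall i, N (F i)) -> N (\sum_(i <- r) F i).
Proof.
by move=> FN; elim/big_ind: _ => //; [apply: N_sub.1|apply: submoduleD].
Qed.

Hypothesis N_alg : algebraically_spanned N.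

Let minor r := exists (U : 'M[{mfps k[n]}]_(r, s)) (c : 'I_r -> 'I_s),
  [/\ forall i, N (row i U), forall i, algebraic_row (row i U) &
      \det (colsub c U) != 0].

Let minor_le r : minor r -> (r <= s)%N.
Proof.
move=> [U [c [_ _ detU]]]; have cinj : injective c.
  move=> i j cij; apply/eqP; apply: contraNT detU => ij.
  rewrite -det_tr (determinant_alternate ij) // => l.
  by rewrite !mxE cij.
by have := leq_card c cinj; rewrite !card_ord.
Qed.

(* L is the matrix of v |-> g v - v_c adj(U_c) U for a maximal nonzero minor
   g = det U_c of algebraic elements of N: by maximality it annihilates N, and
   over the fraction field its kernel is the span of N. *)
Lemma generic_equations : exists (g : {mfps k[n]}) (L : 'M[{mfps k[n]}]_s),
  [/\ g != 0, algebraic_series g, forall i j, algebraic_series (L i j),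
      forall u, N u -> u *m L = 0 & forall v, v *m L = 0 -> N (g *: v)].
Proof.
have minor0 : minor 0.
  exists 0, (fun i : 'I_0 => match i with Ordinal _ h => False_rect _ (notF h) end).
  by split=> [[]//|[]//|]; rewrite det_mx00 oner_neq0.
have ex : exists r, `[< minor r >] by exists 0%N; apply/asboolP.
have bd r : `[< minor r >] -> (r <= s)%N by move/asboolP; apply: minor_le.
case: (ex_maxnP ex bd) => r /asboolP[U [c [UN Ua detU]]] rmax.
pose B := colsub c U; pose g := \det B.
pose C : 'M[{mfps k[n]}]_(s, r) := \matrix_(i, l) (i == c l)%:R.
have mulC (u : 'rV_s) : u *m C = colsub c u.
  apply/rowP => l; rewrite !mxE (bigD1 (c l)) //= !mxE eqxx mulr1 big1 ?addr0 //.
  by move=> i il; rewrite !mxE (negPf il) mulr0.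
pose L := g%:M - C *m \adj B *m U.
have Ba i j : algebraic_series (B i j).
  by rewrite mxE; have := Ua i (c j); rewrite mxE.
have ga : algebraic_series g by apply: algebraic_series_det.
have UlN (x : 'rV_r) : N (x *m U).
  by rewrite mulmx_sum_row; apply: submodule_sum => i; apply: submoduleZ.
exists g, L; split=> //.
- move=> i j; rewrite mxE mxE; apply: algebraic_seriesD.
    by case: (i == j); rewrite ?mulr1n ?mulr0n //; apply: algebraic_series0.
  rewrite mxE; apply: algebraic_seriesN; apply: algebraic_series_mulmx => i' j'.
    apply: algebraic_series_mulmx; last exact: algebraic_series_adj.
    move=> i2 j2; rewrite mxE.
    by case: (_ == _); [apply: algebraic_series1|apply: algebraic_series0].
  by have := Ua i' j'; rewrite mxE.
- have alg_case u : N u -> algebraic_row u -> u *m L = 0.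
    move=> Nu ua; apply/rowP => j; rewrite [RHS]mxE; apply/eqP.
    apply: contraT => uLj.
    (* If (u L)_j is nonzero, bordering B with the row u and the column j gives a nonzero minor of
       size r + 1. *)
    pose c' (i : 'I_(r + 1)) := match split i with inl l => c l | inr _ => j end.
    pose b := colsub (fun _ : 'I_1 => j) U.
    pose A := block_mx B b (colsub c u) (colsub (fun _ : 'I_1 => j) u).
    have AE : colsub c' (col_mx U u) = A.
      apply/matrixP => i l; rewrite !mxE /c'.
      by case: (split i) => i'; rewrite !mxE; case: (split l) => l'; rewrite !mxE ?ord1.
    suff detA : \det A != 0.
      have /rmax : `[< minor (r + 1)%N >].
        apply/asboolP; exists (col_mx U u), c'; split; rewrite ?AE //.
        + move=> i; case: (split_ordP i) => i' ->; first by rewrite rowKu.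
          by rewrite rowKd; have -> : row i' u = u by apply/rowP => l; rewrite mxE ord1.
        + move=> i; case: (split_ordP i) => i' ->; first by rewrite rowKu.
          by rewrite rowKd; have -> : row i' u = u by apply/rowP => l; rewrite mxE ord1.
      by rewrite addn1 ltnn.
    have colsubE m (x : 'M[{mfps k[n]}]_(m, s)) :
        colsub (fun _ : 'I_1 => j) x = x *m col j 1%:M.
      apply/matrixP => i l; rewrite !mxE (bigD1 j) //= !mxE eqxx mulr1 big1 ?addr0 //.
      by move=> l' l'j; rewrite !mxE (negPf l'j) mulr0.
    (* Multiplication by T makes A block triangular, with diagonal blocks g I and (u L)_j. *)
    pose T := block_mx (\adj B) (- (\adj B *m b)) 0 (g%:M : 'M_1).
    have ATE : A *m T = block_mx g%:M 0 (colsub c u *m \adj B) (u *m L *m col j 1%:M).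
      rewrite mulmx_block !mulmx0 !addr0 mul_mx_adj; congr block_mx.
        by rewrite mulmxN mulmxA mul_mx_adj mul_scalar_mx mul_mx_scalar addNr.
      rewrite !colsubE -mulC /L mulmxBr mulmxBl mulmxN addrC; congr (_ - _).
        by rewrite !mul_mx_scalar scalemxAl.
      by rewrite /b colsubE !mulmxA.
    apply: contraTneq (oner_neq0 {mfps k[n]}) => detA.
    have := congr1 determinant ATE; rewrite det_mulmx detA mul0r det_lblock det_scalar det_mx11.
    move/esym/eqP; rewrite mulf_eq0 expf_eq0 (negPf detU) andbF /=.
    by rewrite -colsubE mxE (negPf uLj).
  move=> u /N_alg[m [a [w [wN ->]]]]; rewrite mulmx_suml big1 // => i _.
  by rewrite -scalemxAl alg_case ?scaler0 //; case: (wN i).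
(* Here v L = 0 reads g v = v C adj(B) U, a combination of the rows of U. *)
- move=> v; rewrite mulmxBr mul_mx_scalar !mulmxA => /eqP; rewrite subr_eq0 => /eqP ->.
  exact: UlN.
Qed.

End Submodules.

(** * Regularity in the last variable *)

(** Uniqueness of digits in base D: compare modulo D, then divide by D. *)
Lemma digits_inj (D n : nat) (x y : nat -> nat) :
  (forall i, (i < n.+1)%N -> (x i < D)%N /\ (y i < D)%N) ->
  (\sum_(i < n.+1) x i * D ^ (n - i) = \sum_(i < n.+1) y i * D ^ (n - i))%N ->
  forall i, (i < n.+1)%N -> x i = y i.
Proof.
elim: n => [|n IH] xyD.
  rewrite !big_ord1 subnn expn0 !muln1 => xy i; rewrite ltnS leqn0 => /eqP ->.
  exact: xy.
have shift (z : nat -> nat) : (\sum_(i < n.+2) z i * D ^ (n.+1 - i)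
    = (\sum_(i < n.+1) z i * D ^ (n - i)) * D + z n.+1)%N.
  rewrite big_ord_recr /= subnn expn0 muln1 big_distrl /=; congr addn.
  by apply: eq_bigr => i _; rewrite subSn ?expnSr ?mulnA // -ltnS.
rewrite !shift => E.
have [xl yl] := xyD n.+1 (ltnSn _); have D0 : (0 < D)%N by apply: leq_ltn_trans xl.
have := congr1 (divn^~ D) E; have := congr1 (modn^~ D) E => /=.
rewrite !modnMDl !divnMDl // !(modn_small xl) !(modn_small yl).
rewrite !(divn_small xl) !(divn_small yl) !addn0 => El Es i.
rewrite ltnS leq_eqVlt => /orP[/eqP -> //|]; apply: IH => // j jn.
by apply: xyD; apply: ltnW.
Qed.

Section CoordinateChange.

Context (n : nat) (k : fieldType).

Local Notation ser := (@mfps_of_mpoly _ k).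
Local Notation psub y := (mmap (@mpolyC n.+1 k) y).

(** The exponent is written as e_i + 1 so that no constant term arises. Powers of X, unlike linear
    changes of coordinates, also work over finite fields. *)
Definition shear (e : 'I_n.+1 -> nat) (c : k) : zsubst n.+1 n.+1 k.
Proof.
exists (fun i => if i == ord_max then 'X_ord_max
  else 'X_i + c *: 'X_ord_max ^+ (e i).+1) => i.
have X0 j : ('X_j : {mpoly k[n.+1]})@_0%MM = 0 by rewrite mcoeffX mnm1_eq0.
case: ifP => _ //; rewrite mcoeffD mcoeffZ X0 add0r exprS.
by rewrite (rmorphM (mcoeff 0%MM)) /= X0 mul0r mulr0.
Defined.

Lemma shearK e c f : msubst (shear e (- c)) (msubst (shear e c) f) = f.
Proof.
have y0 i : ('X_i : {mpoly k[n.+1]})@_0%MM = 0 by rewrite mcoeffX mnm1_eq0.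
rewrite (@msubst_comp_ext _ _ _ _ _ _ (ZSubst y0)) ?msubst_id // => i.
pose z : {rmorphism {mpoly k[n.+1]} -> {mpoly k[n.+1]}} := psub (shear e (- c)).
have zX j : z 'X_j = shear e (- c) j by rewrite /z /= mmapX mmap1U.
have zC a : z a%:MP = a%:MP by rewrite /z /= mmapC.
change (z (shear e c i) = 'X_i); rewrite /= -mul_mpolyC.
case: ifP => [/eqP ->|im]; first by rewrite zX /= eqxx.
rewrite rmorphD rmorphM rmorphXn zC !zX /= im eqxx -!mul_mpolyC.
by rewrite mpolyCN mulNr subrK.
Qed.

Let axis (p : {mpoly k[n.+1]}) : {poly k} := map_poly (mcoeff 0%MM) (muni p).

Let coef_axis p j : (axis p)`_j = mfcoef (ser p) (mext 0%MM j).
Proof. by rewrite coef_map pser_muni mfcoef_pser mext_max mrest_ext coef_map. Qed.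

(* With e_i = D^(n-i), the monomials of h restrict to distinct powers of X on the
   curve x_i = X^(e_i). *)
Lemma shear_regular (h : {mpoly k[n.+1]}) : h != 0 ->
  exists e a, xregular a (msubst (shear e 1) (ser h)).
Proof.
(* D exceeds every exponent in h, so these exponents are digits in base D. *)
move=> h0; pose D := (msize h).+2.
pose e (i : 'I_n.+1) := (D ^ (n - i)).-1.
have eS i : (e i).+1 = (D ^ (n - i))%N by rewrite /e prednK // expn_gt0.
exists e; pose g := psub (shear e 1) h.
pose E (m : 'X_{1..n.+1}) := (\sum_i m i * D ^ (n - i))%N.
(* At x' = 0 the shear becomes the substitution x_i = X^(D^(n-i)), which for the last variable is X
   itself. *)
have axisg : axis g = \sum_(m <- msupp h) h@_m *: 'X^(E m).
  pose ax : {rmorphism {mpoly k[n.+1]} -> {poly k}} :=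
    map_poly (mcoeff 0%MM) \o @muni n k.
  transitivity (mmap (@polyC k) (fun i : 'I_n.+1 => 'X^(D ^ (n - i))) h); last first.
    apply: eq_bigr => m _; rewrite mul_polyC; congr (_ *: _).
    by rewrite /mmap1 /E expr_sum; apply: eq_bigr => i _; rewrite -exprM mulnC.
  apply: (@mpoly_hom_ext _ _ _ (ax \o psub (shear e 1)) (mmap (@polyC k) _)) => [c|i].
    by rewrite /= !mmapC muniC map_polyC /= mcoeffC eqxx mulr1.
  have axX : ax 'X_ord_max = 'X.
    by rewrite /ax /= muni_lastX map_polyX.
  rewrite [RHS]mmapX [RHS]mmap1U [LHS]/= mmapX mmap1U /=; case: ifP => [/eqP ->|/eqP im].
    have -> : (n - @ord_max n)%N = 0%N by apply: subnn.
    by rewrite -[LHS]/(ax 'X_ord_max) axX expn0 expr1.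
  rewrite -[LHS]/(ax ('X_i + 1 *: 'X_ord_max ^+ (e i).+1)) scale1r rmorphD rmorphXn axX eS.
  suff -> : ax 'X_i = 0 by rewrite add0r.
  case: (unliftP ord_max i) im => [j|] -> // _.
  by rewrite /ax /= muni_liftX map_polyC /= mcoeffX mnm1_eq0 polyC0.
have Einj m m' : m \in msupp h -> m' \in msupp h -> E m = E m' -> m = m'.
  move=> mh m'h EE; apply/mnmP => i.
  pose x (v : 'X_{1..n.+1}) j := v (inord j).
  have sumE v : E v = (\sum_(j < n.+1) x v j * D ^ (n - j))%N.
    by apply: eq_bigr => j _; rewrite /x inord_val.
  have small v j : v \in msupp h -> (x v j < D)%N.
    move=> vh; apply: (@leq_ltn_trans (mdeg v)).
      by rewrite mdegE (bigD1 (inord j)) //= leq_addr.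
    by rewrite /D; have := msize_mdeg_lt vh; lia.
  have := @digits_inj D n (x m) (x m') _ _ i (ltn_ord i).
  by rewrite /x inord_val; apply=> [j _|]; rewrite -?sumE // !small.
have ex : exists j, (axis g)`_j != 0.
  have mh := mlead_supp h0; exists (E (mlead h)).
  rewrite axisg coef_sum (bigD1_seq _ mh) ?msupp_uniq //= coefZ coefXn eqxx mulr1.
  rewrite big_seq_cond big1 ?addr0 ?mcoeff_eq0 ?mh // => m /andP[mS mm].
  rewrite coefZ coefXn; case: eqP => [Em|]; last by rewrite mulr0.
  by case/eqP: mm; apply: Einj.
exists (ex_minn ex); case: ex_minnP => a ga amin; rewrite msubst_mpoly; split.
  move=> j ja; rewrite -coef_axis; apply/eqP; apply: contraTT ja => gj.
  by rewrite -leqNgt; apply: amin.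
by rewrite -coef_axis.
Qed.

Lemma xregular_mulX a (f : {mfps k[n.+1]}) :
  xregular a f -> xregular a.+1 (f * lastX).
Proof.
have mextS j : mext (0%MM : 'X_{1..n}) j.+1 = (mext 0 j + U_(ord_max))%MM.
  by rewrite /mext mulmSr addmA.
case=> f0 fa; split; last by rewrite mextS mfcoefMX.
case=> [_|j ja]; last by rewrite mextS mfcoefMX f0.
apply: mfcoefMX_eq0; apply/negP => /mnm_lepP /(_ ord_max).
by rewrite mext_max mnm1E eqxx.
Qed.

(** The product rule gives (h X)' = h when h' = 0. *)
Lemma deriv_mulX (h : {mpoly k[n.+1]}) : h != 0 -> (muni h)^`() = 0 ->
  (muni (h * 'X_ord_max))^`() != 0.
Proof.
move=> h0 h'0; have -> : muni (h * 'X_ord_max) = muni h * 'X by rewrite muniM muni_lastX.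
by rewrite derivM h'0 mul0r add0r derivX mulr1 muni_eq0.
Qed.

(* Replacing h by h X makes its derivative in X nonzero. *)
Lemma separable_regular (h : {mpoly k[n.+1]}) : h != 0 ->
  exists (y z : zsubst n.+1 n.+1 k) (a : nat) (h1 h2 : {mpoly k[n.+1]}),
    [/\ cancel (msubst y) (msubst z), cancel (msubst z) (msubst y),
        ser h1 = msubst y (ser (h * h2)), xregular a (ser h1) & (muni h1)^`() != 0].
Proof.
move=> h0; have [e [a ha]] := shear_regular h0.
have yz : cancel (msubst (shear e 1)) (msubst (shear e (-1))) by apply: shearK.
have zy : cancel (msubst (shear e (-1))) (msubst (shear e 1)).
  by move=> f; rewrite -{1}[1]opprK shearK.
exists (shear e 1), (shear e (-1)).
have [h1 h1E] : exists h1, ser h1 = msubst (shear e 1) (ser h).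
  by exists (psub (shear e 1) h); rewrite msubst_mpoly.
have h10 : h1 != 0.
  rewrite -mfps_of_mpoly_eq0 h1E -(rmorph0 (msubst (shear e 1))) (inj_eq (can_inj yz)).
  by rewrite mfps_of_mpoly_eq0.
have [h1'|/eqP h1'] := pselect ((muni h1)^`() = 0).
  (* The shear fixes X, so the factor X is the same in both coordinate systems. *)
  exists a.+1, (h1 * 'X_ord_max), 'X_ord_max; split; [exact: yz|exact: zy| | |].
  - rewrite (rmorphM ser h1) /= h1E (rmorphM ser h) (rmorphM (msubst (shear e 1))) /=.
    by rewrite (msubstX (shear e 1)) /= eqxx.
  - by rewrite rmorphM /=; apply: xregular_mulX; rewrite h1E.
  - exact: deriv_mulX.
exists a, h1, 1; split; [exact: yz|exact: zy| | |exact: h1'].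
  by rewrite mulr1.
by rewrite h1E.
Qed.

End CoordinateChange.

(** * Induction on the number of variables *)

(** The order modulo N is bounded through representatives u of order at least c. The bound uses d +
    1, since even constants may have positive order, and S is a parameter because the induction step
    replaces it by other algebraic series. *)
Definition order_estimate (k : fieldType) (n s : nat)
    (N : 'rV[{mfps k[n]}]_s -> Prop) (S : seq {mfps k[n]}) (C : nat) :=
  forall d (v : 'rV_s), (forall j, gdeg S d (v 0 j)) -> ~ N v ->
  forall c (u : 'rV_s), (forall j, low c (u 0 j)) -> N (v - u) -> (c <= C * d.+1)%N.

Lemma gdeg_sum (k : fieldType) (n : nat) (S : seq {mfps k[n]}) d (I : Type)
    (r : seq I) (F : I -> {mfps k[n]}) :
  (forall i, gdeg S d (F i)) -> gdeg S d (\sum_(i <- r) F i).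
Proof.
move=> Fd; elim/big_ind: _ => //; last by move=> f g; apply: gdegD.
rewrite -(rmorph0 (@mfps_of_mpoly n k)) -(raddf0 (@mpolyC n k)).
exact: gdegW (leq0n _) (gdegC _ _).
Qed.

(** * Reduction modulo a hypersurface *)

Section HypersurfaceStep.

Context (k : fieldType) (n s a : nat) (h : {mpoly k[n.+1]}).

Local Notation ser := (@mfps_of_mpoly _ k).

Hypothesis h_reg : xregular a (ser h).
Hypothesis h_sep : (muni h)^`() != 0.

Local Notation W := (wrem h_reg).
Implicit Types (f : {mfps k[n.+1]}) (v : 'rV[{mfps k[n.+1]}]_s)
  (y : 'rV[{mfps k[n]}]_(s * a)).

(** Remainders identify k[[x]]^s modulo h with k[[x']]^(s a); [lift_row] picks the representatives
    of degree below a in X. *)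
Let rem_row v : 'rV[{mfps k[n]}]_(s * a) :=
  mxvec (\matrix_(i, j) (W (v 0 i))`_j).

Let lift_row y : 'rV[{mfps k[n.+1]}]_s := \row_i pser (rVpoly (row i (vec_mx y))).

Let lift_rowP b y y' : lift_row (b *: y + y') = mwid b *: lift_row y + lift_row y'.
Proof.
apply/rowP => i; rewrite !mxE -pserC -rmorphM -rmorphD /=; congr pser.
by rewrite !linearP /= mul_polyC.
Qed.

Let lift_rowK y : rem_row (lift_row y) = y.
Proof.
rewrite -[RHS]vec_mxK; congr mxvec; apply/matrixP => i j; rewrite !mxE.
rewrite wrem_pser; last exact: size_poly.
by rewrite coef_rVpoly_ord !mxE.
Qed.

Let rem_rowP v : exists q, v = lift_row (rem_row v) + ser h *: q.
Proof.
have ex i := wremP h_reg (v 0 i); pose Q i := projT1 (cid (ex i)).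
exists (\row_i Q i); apply/rowP => i; rewrite !mxE /Q; case: cid => q /= {1}->.
rewrite addrC; congr (_ + _); congr pser; apply/polyP => j.
rewrite mxvecK coef_rVpoly; case: insubP => [l _ <-|]; first by rewrite !mxE.
by rewrite -leqNgt => aj; rewrite nth_default // (leq_trans (size_wrem h_reg _)).
Qed.

Let rem_rowD v w : rem_row (v + w) = rem_row v + rem_row w.
Proof.
rewrite /rem_row -raddfD; congr mxvec; apply/matrixP => i j.
by rewrite !mxE raddfD coefD.
Qed.

Let rem_row_mulh v : rem_row (ser h *: v) = 0.
Proof.
rewrite /rem_row -(raddf0 mxvec); congr mxvec; apply/matrixP => i j.
by rewrite !mxE wrem_mulh coef0.
Qed.

Let rem_row_sum (I : Type) (r : seq I) (F : I -> 'rV[{mfps k[n.+1]}]_s) :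
  rem_row (\sum_(i <- r) F i) = \sum_(i <- r) rem_row (F i).
Proof.
have rem0 : rem_row 0 = 0 by rewrite -(scaler0 _ (ser h)) rem_row_mulh.
by rewrite (big_morph rem_row rem_rowD rem0).
Qed.

(** Modulo h, the series f is a combination of 1, ..., X^(a-1) over k[[x']], and taking remainders
    is k[[x']]-linear. *)
Let wrem_expand (f g : {mfps k[n.+1]}) :
  W (f * g) = \sum_(l < a) (W f)`_l *: W (lastX ^+ l * g).
Proof.
rewrite wrem_mulr (pserE (size_wrem h_reg f)) mulr_suml raddf_sum.
by apply: eq_bigr => l _; rewrite /= -mulrA wrem_wid.
Qed.

Let rem_row_scale f v :
  rem_row (f *: v) = \sum_(l < a) (W f)`_l *: rem_row (lastX ^+ l *: v).
Proof.
rewrite /rem_row; under eq_bigr do rewrite -linearZ /=.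
rewrite -raddf_sum; congr mxvec; apply/matrixP => i j; rewrite !mxE wrem_expand.
by rewrite coef_sum summxE; apply: eq_bigr => l _; rewrite !mxE coefZ.
Qed.

(** Entries of the matrices of multiplication by the members of S on k[[x]]/(h), in the basis of
    powers of X. *)
Let multipliers (S : seq {mfps k[n.+1]}) :=
  flatten [seq [seq (W (lastX ^+ i * f))`_j | i <- iota 0 a, j <- iota 0 a] | f <- S].

Variable N : 'rV[{mfps k[n.+1]}]_s -> Prop.
Hypotheses (N_sub : submodule N) (N_alg : algebraically_spanned N).

(** The image of N in k[[x']]^(s a), that is, N + h k[[x]]^s modulo h. *)
Let N1 y := exists q, N (lift_row y + ser h *: q).

Let N1_sub : submodule N1.
Proof.
split.
  exists 0; rewrite scaler0 addr0; suff -> : lift_row 0 = 0 by apply: N_sub.1.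
  by apply/rowP => i; rewrite !mxE !raddf0.
move=> b y y' [q Nq] [q' Nq']; exists (mwid b *: q + q').
have := N_sub.2 (mwid b) _ _ Nq Nq'.
rewrite lift_rowP !scalerDr !scalerA addrACA; congr N.
by rewrite [ser h * _]mulrC.
Qed.

Let N1_rem v q : N (v + ser h *: q) -> N1 (rem_row v).
Proof.
have [q' {1}->] := rem_rowP v; rewrite -addrA -scalerDr => Nv.
by exists (q' + q).
Qed.

Let rem_N1 v : N1 (rem_row v) -> exists q, N (v + ser h *: q).
Proof.
move=> [q Nq]; have [q' vE] := rem_rowP v; exists (q - q').
by rewrite {1}vE scalerBr -addrA [ser h *: q' + _]addrC subrK.
Qed.

(** Over k[[x']] the image is spanned by the remainders of X^l w, with l < a and w an algebraic
    element of N; they are algebraic by [algebraic_wrem]. *)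
Let N1_alg : algebraically_spanned N1.
Proof.
move=> y [q /N_alg[r [b [w [wN E]]]]].
have -> : y = rem_row (lift_row y + ser h *: q).
  by rewrite rem_rowD rem_row_mulh addr0 lift_rowK.
rewrite E rem_row_sum; apply: lin_span_sum => i.
rewrite rem_row_scale; apply: lin_span_sum => l; apply: lin_span_scale.
have [Nw wa] := wN i; split.
  by apply: (@N1_rem _ 0); rewrite scaler0 addr0; apply: submoduleZ.
move=> j; case/mxvec_indexP: j => i' j'; rewrite mxvecE !mxE.
apply: algebraic_wrem => //; apply: algebraic_seriesM => //.
by rewrite -rmorphXn; apply: algebraic_mpoly.
Qed.

(** Products of series give products of multiplication matrices, so taking remainders does not
    increase the degree. *)
Let gdeg_wrem S d f : gdeg S d f -> forall i j, (i < a)%N -> (j < a)%N ->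
  gdeg (multipliers S) d (W (lastX ^+ i * f))`_j.
Proof.
have gdeg0 e : gdeg (multipliers S) e 0.
  rewrite -(rmorph0 (@mfps_of_mpoly n k)) -(raddf0 (@mpolyC n k)).
  exact: gdegW (leq0n _) (gdegC _ _).
elim=> {d f} [c|f fS|d f g _ IHf _ IHg|d e f g _ IHf _ IHg|d e f de _ IHf] i j ia ja.
- rewrite -(msubstC (zins k ord_max)).
  rewrite mulrC wrem_wid -pserX -rmorphXn wrem_pser ?size_polyXn //.
  rewrite coefZ coefXn; case: eqP => _; last by rewrite mulr0.
  by rewrite mulr1; apply: gdegC.
- apply: gdegG; apply/flattenP.
  exists [seq (W (lastX ^+ i * f))`_j | i <- iota 0 a, j <- iota 0 a].
    by apply/mapP; exists f.
  by apply/allpairsP; exists (i, j); rewrite !mem_iota.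
- by rewrite mulrDr raddfD coefD; apply: gdegD; [apply: IHf|apply: IHg].
- rewrite mulrA wrem_expand coef_sum; apply: gdeg_sum => l; rewrite coefZ.
  by apply: gdegM; [apply: IHf|apply: IHg].
- exact: gdegW de (IHf _ _ ia ja).
Qed.

(** The total degree is at most the weight, and taking remainders does not lower the weight. The
    coefficient of X^j loses j < a, and each variable in x' counts a + 1. *)
Let low_wrem c f : low c f -> forall j, low (c %/ a.+1) (W f)`_j.
Proof.
move=> fc j m mc; have [ja|aj] := ltnP j a; last first.
  by rewrite nth_default // (leq_trans (size_wrem h_reg f)).
have [Q fE] := wremP h_reg f.
have fw : wlow (@xwt n a) c f.
  by apply: wlow_leW fc => v; rewrite /xwt mdeg_rest; nia.
have := weierstrass_rem_wlow h_reg (size_wrem h_reg f) fE fw.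
move/(_ (mext m j)); rewrite mfcoef_pser mext_max mrest_ext; apply.
rewrite /xwt mext_max mrest_ext.
have := leq_trunc_div c a.+1; nia.
Qed.

Lemma hypersurface_step (S : seq {mfps k[n.+1]}) :
  (forall f, f \in S -> algebraic_series f) ->
  (forall (N1 : 'rV[{mfps k[n]}]_(s * a) -> Prop), submodule N1 ->
     algebraically_spanned N1 -> forall S1 : seq {mfps k[n]},
     (forall g, g \in S1 -> algebraic_series g) -> exists C, order_estimate N1 S1 C) ->
  exists C, forall d (v : 'rV_s), (forall j, gdeg S d (v 0 j)) ->
    ~ (exists q, N (v + ser h *: q)) ->
    forall c (u : 'rV_s), (forall j, low c (u 0 j)) -> N (v - u) -> (c <= C * d.+1)%N.
Proof.
move=> Sa IH; have [|C CP] := IH N1 N1_sub N1_alg (multipliers S).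
  move=> f /flattenP[l /mapP[g gS ->] /allpairsP[[i j] [_ _ ->]]].
  apply: algebraic_wrem => //; apply: algebraic_seriesM; last exact: Sa.
  by rewrite -rmorphXn; apply: algebraic_mpoly.
(* With integer division, c < (c / (a + 1) + 1) (a + 1), and the quotient is at most C (d + 1). *)
exists (C.+1 * a.+1)%N => d v vd vN c u uc Nvu.
have lec : (c %/ a.+1 <= C * d.+1)%N.
  apply: (CP d (rem_row v) _ _ _ (rem_row u)).
  - move=> l; case/mxvec_indexP: l => i j; rewrite mxvecE !mxE.
    have a0 : (0 < a)%N by apply: leq_ltn_trans (ltn_ord j).
    by have := gdeg_wrem (vd i) a0 (ltn_ord j); rewrite expr0 mul1r.
  - by move/rem_N1.
  - by move=> l; case/mxvec_indexP: l => i j; rewrite mxvecE !mxE; apply: low_wrem.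
  - have -> : rem_row v - rem_row u = rem_row (v - u).
      by apply/eqP; rewrite subr_eq -rem_rowD subrK.
    by apply: (@N1_rem _ 0); rewrite scaler0 addr0.
have := ltn_ceil c (ltn0Sn a); nia.
Qed.

End HypersurfaceStep.

Lemma map_mx_cancel (T : Type) (f g : T -> T) m n :
  cancel f g -> cancel (@map_mx T T f m n) (map_mx g).
Proof. by move=> fg A; apply/matrixP => i j; rewrite !mxE fg. Qed.

(** * Transport along a change of coordinates *)

Section Transport.

Context (k : fieldType) (n s : nat) (y z : zsubst n n k).
Hypotheses (yz : cancel (msubst y) (msubst z)) (zy : cancel (msubst z) (msubst y)).

Let mmap_y_inj : injective (mmap (@mpolyC n k) y).
Proof.
move=> p q pq; apply: (@mfps_of_mpoly_inj n k); apply: (can_inj yz).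
by rewrite !msubst_mpoly pq.
Qed.

Lemma algebraic_msubst f : algebraic_series f -> algebraic_series (msubst y f).
Proof.
move=> [P P0 Pf]; exists (map_poly (mmap (@mpolyC n k) y) P).
  rewrite map_poly_eq0_id0 // -(rmorph0 (mmap (@mpolyC n k) y)).
  by rewrite (inj_eq mmap_y_inj) lead_coef_eq0.
have -> : map_poly (@mfps_of_mpoly n k) (map_poly (mmap (@mpolyC n k) y) P) =
    map_poly (msubst y) (map_poly (@mfps_of_mpoly n k) P).
  by rewrite -!map_poly_comp; apply: eq_map_poly => p /=; rewrite msubst_mpoly.
exact: rmorph_root.
Qed.

Lemma gdeg_msubst S d f : gdeg S d f -> gdeg (map (msubst y) S) d (msubst y f).
Proof.
elim=> {d f} [c|f fS|d f g _ IHf _ IHg|d e f g _ IHf _ IHg|d e f de _ IHf].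
- by rewrite msubstC; apply: gdegC.
- by apply: gdegG; apply: map_f.
- by rewrite rmorphD; apply: gdegD.
- by rewrite rmorphM; apply: gdegM.
- exact: gdegW de IHf.
Qed.

Variable N : 'rV[{mfps k[n]}]_s -> Prop.

Definition transported (v : 'rV[{mfps k[n]}]_s) := N (map_mx (msubst z) v).

Lemma transported_submodule : submodule N -> submodule transported.
Proof.
move=> N_sub; split; first by rewrite /transported map_mx0; apply: N_sub.1.
move=> b u v Nu Nv; rewrite /transported map_mxD map_mxZ; exact: N_sub.2.
Qed.

Lemma transported_alg : algebraically_spanned N -> algebraically_spanned transported.
Proof.
move=> N_alg v /N_alg[r [b [w [wN E]]]].
exists r, (fun i => msubst y (b i)), (fun i => map_mx (msubst y) (w i)); split.
  move=> i; have [Nw wa] := wN i; split.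
    by rewrite /transported (map_mx_cancel yz).
  by move=> j; rewrite mxE; apply: algebraic_msubst.
rewrite -(map_mx_cancel zy v).
by rewrite E raddf_sum; apply: eq_bigr => i _; rewrite /= map_mxZ.
Qed.

End Transport.

Lemma submodule_order_estimate (k : fieldType) (n s : nat)
    (N : 'rV[{mfps k[n]}]_s -> Prop) :
  submodule N -> algebraically_spanned N ->
  forall S : seq {mfps k[n]}, (forall f, f \in S -> algebraic_series f) ->
  exists C, order_estimate N S C.
Proof.
elim: n s N => [|n IH] s N N_sub N_alg S Sa.
  (* Without variables a series of positive order is zero, so v itself would lie in N. *)
  exists 0%N => d v _ vN [//|c] u uc Nvu; case: vN.
  suff u0 : u = 0 by move: Nvu; rewrite u0 subr0.
  apply/rowP => j; rewrite mxE; apply: mfpsP => m; have := uc j m; apply.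
  by rewrite (nvar0_mnmE m) mdeg0.
have [g [L [g0 ga La NL LN]]] := generic_equations N_sub N_alg.
have [h0 h00 [g' h0E]] := algebraic_divides_mpoly ga g0.
have [y [z [a [h [e [yz zy hE h_reg h_sep]]]]]] := separable_regular h00.
(* The entries of L join S, so that the entries of v L have degree at most d + 1. *)
have [|C1 C1P] := @gdeg_order_bound k n.+1 (S ++ [seq L i.1 i.2 | i <- enum predT]).
  by move=> f; rewrite mem_cat => /orP[/Sa //|/mapP[i _ ->]].
have Sya f : f \in map (msubst y) S -> algebraic_series f.
  by case/mapP => f' /Sa f'a ->; apply: (algebraic_msubst yz).
have [C2 C2P] := hypersurface_step h_reg h_sep (transported_submodule z N_sub)
  (transported_alg yz zy N_alg) Sya (IH _).
exists (C1 + C2)%N => d v vd vN c u uc Nvu.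
have [vL|/eqP vL] := pselect (v *m L = 0); last first.
  have [j vLj] : exists j, (v *m L) 0 j != 0.
    apply: contrapT => nex; case/eqP: vL; apply/rowP => j; rewrite [RHS]mxE.
    by apply/eqP; apply: contrapT => /negP vLj; apply: nex; exists j.
  have uL : v *m L = u *m L.
    by apply/eqP; rewrite -subr_eq0 -mulmxBl NL.
  apply: (@leq_trans (C1 * d.+1)); last by rewrite leq_mul2r leq_addr orbT.
  rewrite -addn1; apply: (C1P _ ((v *m L) 0 j)) => //.
    rewrite mxE; apply: gdeg_sum => i; apply: gdegM.
      elim: {vN vL vLj uL Nvu} (vd i) => {d vd}
        [c'|f fS|d f f' _ If _ If'|d d' f f' _ If _ If'|d d' f dd _ If].
      - exact: gdegC.
      - by apply: gdegG; rewrite mem_cat fS.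
      - exact: gdegD.
      - exact: gdegM.
      - exact: gdegW dd If.
    apply: gdegG; rewrite mem_cat; apply/orP; right.
    by apply/mapP; exists (i, j); rewrite ?mem_enum.
  rewrite uL mxE; apply: wlow_sum => i _; rewrite mulrC.
  by apply: wlowMl => //; apply: mdegD.
apply: (@leq_trans (C2 * d.+1)); last by rewrite leq_mul2r leq_addl orbT.
apply: (C2P d (map_mx (msubst y) v) _ _ c (map_mx (msubst y) u)).
- by move=> j; rewrite mxE; apply: gdeg_msubst.
- move=> [q]; rewrite /transported map_mxD map_mxZ (map_mx_cancel yz).
  rewrite /= hE yz => Nvq; apply: vN.
  set q' := map_mx _ q in Nvq; set H := mfps_of_mpoly _ in Nvq.
  have H0 : H != 0.
    have h1 : mfps_of_mpoly h != 0.
      by apply: contraTneq (h_reg.2) => ->; rewrite eqxx.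
    by apply: contraNneq h1 => H0; rewrite hE -/H H0 rmorph0.
  (* Since L annihilates v and N, it annihilates H q', hence q'. As H is a multiple of g, the
     product H q' lies in N, and so does v. *)
  have q'L : q' *m L = 0.
    have := NL _ Nvq; rewrite mulmxDl vL add0r -scalemxAl => /eqP.
    by rewrite scalemx_eq0 (negPf H0) => /eqP.
  have NHq : N (H *: q').
    have -> : H *: q' = (mfps_of_mpoly e * g') *: (g *: q').
      by rewrite scalerA /H rmorphM /= h0E; congr (_ *: _); ring.
    by apply: submoduleZ => //; apply: LN.
  have := submoduleD N_sub Nvq (submoduleN N_sub NHq).
  by rewrite addrK.
- by move=> j; rewrite mxE; apply: low_msubst.
- by rewrite /transported map_mxB !(map_mx_cancel yz).
Qed.

(** * From the estimate for submodules to polynomial vectors *)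

Lemma gdeg_mpoly (k : fieldType) (n : nat) (p : {mpoly k[n]}) :
  gdeg [seq mfps_of_mpoly 'X_i | i <- enum 'I_n] (msize p).-1 (mfps_of_mpoly p).
Proof.
set S := map _ _; rewrite [p in mfps_of_mpoly p]mpolyE raddf_sum big_seq.
have gX (m : 'X_{1..n}) : gdeg S (mdeg m) (mfps_of_mpoly 'X_[m]).
  rewrite mpolyXE_id rmorph_prod mdegE /=.
  elim: (index_enum _) => [|i r IHr].
    by rewrite !big_nil -(rmorph1 (@mfps_of_mpoly n k)) -mpolyC1; apply: gdegC.
  rewrite !big_cons; apply: gdegM => //; rewrite rmorphXn.
  elim: (m i) => [|j IHj].
    by rewrite expr0 -(rmorph1 (@mfps_of_mpoly n k)) -mpolyC1; apply: gdegC.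
  rewrite exprS -add1n; apply: gdegM => //; apply: gdegG.
  by apply/mapP; exists i; rewrite ?mem_enum.
elim/big_ind: _ => [|f g|m mp].
- rewrite -(rmorph0 (@mfps_of_mpoly n k)) -(raddf0 (@mpolyC n k)).
  exact: gdegW (leq0n _) (gdegC _ _).
- exact: gdegD.
- rewrite /= -mul_mpolyC rmorphM /=; apply: (@gdegW _ _ _ (0 + mdeg m)).
    by have := msize_mdeg_lt mp; lia.
  by apply: gdegM; [apply: gdegC|apply: gX].
Qed.

(** The generators of (x)^c are monomials of degree c, and multiplication does not lower the
    order. *)
Lemma low_class (k : fieldType) (n s c : nat) (v : 'rV[{mfps k[n]}]_s) :
  lin_span (fun w => exists (f : {mfps k[n]}) (w' : 'rV[{mfps k[n]}]_s),
    xideal_exp c f /\ w = f *: w') v ->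
  forall j, low c (v 0 j).
Proof.
move=> [r [b [w [wc ->]]]] j; rewrite summxE; apply: wlow_sum => i _.
have [f [w' [[t [e [m [mc ->]]]] ->]]] := wc i.
rewrite !mxE mulrCA mulrC; apply: wlowMl; first exact: mdegD.
apply: wlow_sum => l _; apply: wlowMl; first exact: mdegD.
have [m0 m0c ->] := mc l => u uc; rewrite /= mcoeffX; case: eqP => // m0u.
by move: uc; rewrite -m0u m0c ltnn.
Qed.

Theorem corollary1p2 (k : fieldType) (n s : nat)
    (N : {pred 'rV[{mfps k[n]}]_s}) :
  submod_closed N ->
  (exists2 L : {pred 'rV[{mfps k[n]}]_s}, algebraic_submodule L &
     forall v, v \in N <-> lin_span (fun w => w \in L) v) ->
  exists C' : nat, (0 < C')%N /\
    forall p : 'rV[{mpoly k[n]}]_s, pvec_series p \notin N ->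
      exists o : nat, has_ord N (pvec_series p) o /\
        (o <= C' * maxn 1 (pvec_deg p))%N.
Proof.
move=> [N0 NP] [L [La _ _] NL].
have N_sub : submodule (fun v => v \in N) by split.
have N_alg : algebraically_spanned (fun v => v \in N).
  (* The members of L lie in N and are algebraic, so they can serve as the spanning elements. *)
  move=> v /NL[r [b [w [wL ->]]]]; exists r, b, w; split=> // i; split; last exact: La.
  by apply/NL; rewrite -[w i]scale1r; apply: lin_span_scale.
have [|C CP] := submodule_order_estimate N_sub N_alg
    (S := [seq mfps_of_mpoly 'X_i | i <- enum 'I_n]).
  by move=> f /mapP[i _ ->]; apply: algebraic_mpoly.
(* The factor 2 comes from deg p + 1 <= 2 max(1, deg p); the successor keeps the constant
   positive. *)
exists (2 * C.+1)%N; split=> // p pN.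
have bound c : class_in_xexp N c (pvec_series p) -> (c <= C * (pvec_deg p).+1)%N.
  move=> [u uc Npu]; apply: (CP _ (pvec_series p) _ _ c u) => //.
  - move=> j; rewrite mxE; apply: gdegW (gdeg_mpoly _).
    by rewrite /pvec_deg (leq_bigmax j).
  - exact/negP.
  - exact: low_class.
(* The order is the least upper bound of the admissible c, which exists because they are bounded. *)
have ex : exists b, `[< forall c, class_in_xexp N c (pvec_series p) -> (c <= b)%N >].
  by exists (C * (pvec_deg p).+1)%N; apply/asboolP.
exists (ex_minn ex); case: ex_minnP => o /asboolP oP omin; split; first split=> //.
  by move=> b bP; apply: omin; apply/asboolP.
have := omin _ (introT (asboolP _) bound); have := leq_maxl 1 (pvec_deg p).
have := leq_maxr 1 (pvec_deg p); nia.
Qed.
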